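(* Let $(M,L)$ and $(M,\widetilde L)$ be conformally related Finsler manifolds with $\widetilde g=e^{2\sigma(x)}g$. Then the v-, hv- and h-curvature tensors of the associated Chern connections $D^c$, $\widetilde{D^c}$ satisfy, for all $\pi$-vector fields $\overline X,\overline Y,\overline Z$: (a) $\widetilde{S^{c}}(\overline{X},\overline{Y})\overline{Z}=S^{c}(\overline{X},\overline{Y})\overline{Z}=0$; (b) $\widetilde{P^{c}}(\overline{X},\overline{Y})\overline{Z}=P^{c}(\overline{X},\overline{Y})\overline{Z}+(D^{c}_{\gamma\overline{Y}}B^{c})(\overline{X},\overline{Z})$; (c) $\widetilde{R^{c}}(\overline{X},\overline{Y})\overline{Z}=R^{c}(\overline{X},\overline{Y})\overline{Z}+\mathfrak{U}_{\overline{X},\overline{Y}}\{(D^{c}_{\gamma N\overline{X}}B^{c})(\overline{Y},\overline{Z})-(D^{c}_{\beta\overline{X}}B^{c})(\overline{Y},\overline{Z})+P^{c}(\overline{Y},N\overline{X})\overline{Z}-B^{c}(\overline{X},B^{c}(\overline{Y},\overline{Z}))\}$.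
   Context: $M$ is a real paracompact $C^\infty$ manifold of finite dimension $n$; all objects are $C^\infty$. $\pi:\mathcal{T}M\to M$ is the bundle of nonzero tangent vectors, $\pi^{-1}(TM)$ the pullback of $TM$ by $\pi$. Sections of $\pi^{-1}(TM)$ are called $\pi$-vector fields and written $\overline X,\overline Y,\dots$; $\overline\eta(u)=(u,u)$. $\rho:T(\mathcal{T}M)\to\pi^{-1}(TM)$ is $\rho=(\pi_{\mathcal{T}M},d\pi)$ and $\gamma:\pi^{-1}(TM)\to T(\mathcal{T}M)$ is the vertical lift. For a linear connection $D$ on $\pi^{-1}(TM)$, $K(X):=D_X\overline\eta$; $D$ is regular if $T(\mathcal{T}M)=V(\mathcal{T}M)\oplus H(\mathcal{T}M)$ with $H=\ker K$, $V$ the vertical bundle, and then $\beta:=(\rho|_{H})^{-1}$. Torsion: $\mathbf{T}(X,Y)=D_X\rho Y-D_Y\rho X-\rho[X,Y]$, $Q(\overline X,\overline Y)=\mathbf{T}(\beta\overline X,\beta\overline Y)$, $T(\overline X,\overline Y)=\mathbf{T}(\gamma\overline X,\beta\overline Y)$. Curvature: $\mathbf{K}(X,Y)\rho Z=-D_XD_Y\rho Z+D_YD_X\rho Z+D_{[X,Y]}\rho Z$, with h-, hv-, v-curvature tensors $R(\overline X,\overline Y)\overline Z=\mathbf{K}(\beta\overline X,\beta\overline Y)\overline Z$, $P(\overline X,\overline Y)\overline Z=\mathbf{K}(\beta\overline X,\gamma\overline Y)\overline Z$, $S(\overline X,\overline Y)\overline Z=\mathbf{K}(\gamma\overline X,\gamma\overline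 Y)\overline Z$. $(M,L)$ is a Finsler manifold and $g$ the Finsler metric on $\pi^{-1}(TM)$ defined by $L$. The Cartan connection $\nabla$ is the unique regular connection with $\nabla g=0$, $Q=0$ and $g(T(\overline X,\overline Y),\overline Z)=g(T(\overline X,\overline Z),\overline Y)$; $T$, $K$, $\beta$ denote those of $\nabla$. The Chern (Rund) connection is $D^{c}_X\overline Y=\nabla_X\overline Y-T(KX,\overline Y)$ (same $\beta$, $K$); its curvature tensors are $R^c,P^c,S^c$. $(M,L)$ and $(M,\widetilde L)$ are conformally related if $\widetilde g=e^{2\sigma(x)}g$ for a positive differentiable function $\sigma$ on $M$. Objects of $(M,\widetilde L)$ carry a tilde (in particular $\widetilde{P^c}$, $\widetilde{R^c}$ are formed with $\widetilde\beta$). $N(\overline X):=\widetilde\nabla_{\beta\overline X}\overline\eta-\nabla_{\beta\overline X}\overline\eta$, so that $\widetilde\beta=\beta-\gamma\circ N$. $B^{c}(\overline X,\overline Y):=\omega^c(\beta\overline X,\overline Y)$, where $\omega^c(X,\overline Y):=\widetilde{D^c}_X\overline Y-D^c_X\overline Y$. $\mathfrak{U}_{\overline X,\overline Y}\{A(\overline X,\overline Y)\}:=A(\overline X,\overline Y)-A(\overline Y,\overline X)$. *)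

(* Defs.v *)
From HB Require Import structures.
From mathcomp Require Import all_boot all_order all_algebra.
From mathcomp Require Import all_classical all_reals all_analysis.

Set Implicit Arguments.
Unset Strict Implicit.
Unset Printing Implicit Defensive.
Import Order.TTheory GRing.Theory Num.Theory.
Import numFieldNormedType.Exports.
Local Open Scope classical_set_scope.
Local Open Scope ring_scope.

(* In finite dimension, f is C^(k+1) on an open set U iff it is differentiable
   on U with all its directional derivatives C^k on U. *)
Fixpoint Ck {R : realType} {V W : normedModType R} (k : nat) (U : set V)
    (f : V -> W) : Prop :=
  if k is k'.+1 then
    (forall x, U x -> differentiable f x) /\ (forall v, Ck k' U ('D_v f))
  else forall x, U x -> {for x, continuous f}.

Definition Cinfty {R : realType} {V W : normedModType R} (U : set V)
    (f : V -> W) : Prop := forall k, Ck k U f.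

(* [point c] is the inverse of the chart [coord c : dom c -> R^m]; both are
   total functions, meaningful only on [dom c] and on its image.
   [chart_at p] is a chosen chart around [p]. *)
Record atlas (R : realType) (N : Type) (m : nat) := Atlas {
  chart : Type;
  dom : chart -> set N;
  coord : chart -> N -> 'rV[R]_m;
  point : chart -> 'rV[R]_m -> N;
  chart_at : N -> chart }.

Record smooth_atlas (R : realType) (M : topologicalType) (n : nat)
    (A : atlas R M n) : Prop := {
  dom_chart_at : forall p, dom (chart_at A p) p;
  open_dom : forall c : chart A, open (dom c);
  open_image : forall c : chart A, open (coord c @` dom c);
  coordK : forall (c : chart A) p, dom c p -> point c (coord c p) = p;
  coord_continuous : forall (c : chart A) p, dom c p ->
    {for p, continuous (coord c)};
  point_continuous : forall (c : chart A) z, (coord c @` dom c) z ->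
    {for z, continuous (point c)};
  transition_smooth : forall c d : chart A,
    Cinfty (coord c @` (dom c `&` dom d)) (coord d \o point c) }.

Definition paracompact (T : topologicalType) : Prop :=
  forall C : set (set T),
    (forall A, C A -> open A) -> \bigcup_(A in C) A = setT ->
  exists D : set (set T),
    [/\ forall B, D B -> open B,
        \bigcup_(B in D) B = setT,
        forall B, D B -> exists2 A, C A & B `<=` A
      & forall x : T, exists2 U, nbhs x U &
          finite_set [set B | D B /\ B `&` U !=set0]].

Definition is_manifold (R : realType) (M : topologicalType) (n : nat)
    (A : atlas R M n) : Prop :=
  [/\ hausdorff_space M, paracompact M & smooth_atlas A].

(* Calculus on a set N with an atlas. The tangent space T_pN is R^m, a vector
   being given by its components in the chart [chart_at A p]. *)
Section AtlasCalculus.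
Context {R : realType} {N : Type} {m : nat} (A : atlas R N m).

(* The chart [chart_at A p] determines smoothness near p, since transition maps
   are smooth. *)
Definition smooth_at {W : normedModType R} (f : N -> W) (p : N) : Prop :=
  exists2 U, open_nbhs (coord (chart_at A p) p) U
           & Cinfty U (f \o point (chart_at A p)).

(* Components in the chart [c] of the vector v of T_pN. *)
Definition tcoord (c : chart A) (p : N) (v : 'rV[R]_m) : 'rV[R]_m :=
  'd (coord c \o point (chart_at A p)) (coord (chart_at A p) p) v.

Definition dir_deriv {W : normedModType R} (f : N -> W) (p : N)
    (v : 'rV[R]_m) : W :=
  'D_v (f \o point (chart_at A p)) (coord (chart_at A p) p).

Definition smooth_field_at (X : N -> 'rV[R]_m) (p : N) : Prop :=
  smooth_at (fun q => tcoord (chart_at A p) q (X q)) p.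

Definition field_in_chart (c : chart A) (X : N -> 'rV[R]_m) (z : 'rV[R]_m) :
    'rV[R]_m := tcoord c (point c z) (X (point c z)).

(* [X, Y]^i = X^j d_j Y^i - Y^j d_j X^i in the chart [chart_at A p]. *)
Definition lie_bracket (X Y : N -> 'rV[R]_m) (p : N) : 'rV[R]_m :=
  let c := chart_at A p in
  'D_(X p) (field_in_chart c Y) (coord c p)
  - 'D_(Y p) (field_in_chart c X) (coord c p).

End AtlasCalculus.

Definition tangent_map {R : realType} {N N' : Type} {m m' : nat}
    (A : atlas R N m) (A' : atlas R N' m') (F : N -> N') (p : N)
    (v : 'rV[R]_m) : 'rV[R]_m' :=
  dir_deriv A (coord (chart_at A' (F p)) \o F) p v.

(* [vec u] gives the components of u in the chart [chart_at A (base u)]. *)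
Record tangent_bundle {R : realType} {M : Type} {n : nat} (A : atlas R M n) :=
  TVec { base : M; vec : 'rV[R]_n }.

Arguments TVec {R M n A}.
Arguments base {R M n A}.
Arguments vec {R M n A}.

Section PullbackBundle.
Context {R : realType} {M : Type} {n : nat} (A : atlas R M n).
Local Notation TM := (tangent_bundle A).

(* The charts (x, y) of TM induced by the charts x of M. *)
Definition tatlas : atlas R TM (n + n) := {|
  chart := chart A;
  dom := fun c => [set u | dom c (base u)];
  coord := fun c u => row_mx (coord c (base u)) (tcoord c (base u) (vec u));
  point := fun c z =>
    let x := point c (lsubmx z) in
    TVec x ('d (coord (chart_at A x) \o point c) (lsubmx z) (rsubmx z));
  chart_at := fun u => chart_at A (base u) |}.

(* The bundle of nonzero tangent vectors, an open subset of TM. Objects living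
   on it are total functions on TM, whose values outside [slit] are
   irrelevant. *)
Definition slit : set TM := [set u | vec u != 0].

(* X u is in T_u(TM); Y u is in the fibre T_(base u)M of the pullback bundle. *)
Definition vfield := TM -> 'rV[R]_(n + n).
Definition pifield := TM -> 'rV[R]_n.

Definition smooth_vfield (X : vfield) : Prop :=
  forall u, slit u -> smooth_field_at tatlas X u.

Definition smooth_pifield_at (Y : pifield) (u : TM) : Prop :=
  smooth_at tatlas (fun w => tcoord (chart_at A (base u)) (base w) (Y w)) u.

Definition smooth_pifield (Y : pifield) : Prop :=
  forall u, slit u -> smooth_pifield_at Y u.

Definition eta : pifield := fun u => vec u.

Definition rho_at (u : TM) (xi : 'rV[R]_(n + n)) : 'rV[R]_n :=
  tangent_map tatlas A base u xi.

(* The velocity at t = 0 of the curve u + t v. *)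
Definition gamma_at (u : TM) (v : 'rV[R]_n) : 'rV[R]_(n + n) :=
  derive1 (fun t : R =>
    coord (chart_at tatlas u) (TVec (base u) (vec u + t *: v))) 0.

Definition rho (X : vfield) : pifield := fun u => rho_at u (X u).
Definition gamma (Y : pifield) : vfield := fun u => gamma_at u (Y u).

(* [D u xi Y] is D_xi Y, for u in [slit], xi in T_u(TM) and Y a section of the
   pullback bundle that is smooth near u. *)
Definition connection := forall u : TM, 'rV[R]_(n + n) -> pifield -> 'rV[R]_n.

(* In the Leibniz rule f is smooth near u only; the indicator functions of the
   neighbourhoods of u are thus allowed, which makes D a local operator. *)
Record linear_connection (D : connection) : Prop := {
  conn_linear : forall u (a : R) xi zeta Y, slit u -> smooth_pifield_at Y u ->
    D u (a *: xi + zeta) Y = a *: D u xi Y + D u zeta Y;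
  conn_add : forall u xi Y Z, slit u ->
    smooth_pifield_at Y u -> smooth_pifield_at Z u ->
    D u xi (Y \+ Z) = D u xi Y + D u xi Z;
  conn_leibniz : forall u xi (f : TM -> R) Y, slit u ->
    smooth_at tatlas f u -> smooth_pifield_at Y u ->
    D u xi (fun w => f w *: Y w) =
      f u *: D u xi Y + dir_deriv tatlas f u xi *: Y u;
  conn_smooth : forall u (X : vfield) Y, slit u ->
    smooth_field_at tatlas X u -> smooth_pifield_at Y u ->
    smooth_pifield_at (fun w => D w (X w) Y) u }.

Definition Kmap_at (D : connection) (u : TM) (xi : 'rV[R]_(n + n)) : 'rV[R]_n :=
  D u xi eta.

Definition Kmap (D : connection) (X : vfield) : pifield :=
  fun u => Kmap_at D u (X u).

(* T_u(TM) is the direct sum of the vertical space, which is the kernel of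
   [rho_at u], and of the horizontal space, the kernel of K. *)
Definition regular (D : connection) : Prop :=
  forall u, slit u ->
    (forall xi, exists v h,
       [/\ rho_at u v = 0, Kmap_at D u h = 0 & xi = v + h]) /\
    (forall xi, rho_at u xi = 0 -> Kmap_at D u xi = 0 -> xi = 0).

Definition beta_at (D : connection) (u : TM) (v : 'rV[R]_n) : 'rV[R]_(n + n) :=
  xget 0 [set xi | Kmap_at D u xi = 0 /\ rho_at u xi = v].

Definition beta (D : connection) (Y : pifield) : vfield :=
  fun u => beta_at D u (Y u).

(* The operator (X, Y) |-> D_X Y on fields. *)
Definition deriv_op := vfield -> pifield -> pifield.

Definition conn_op (D : connection) : deriv_op := fun X Y u => D u (X u) Y.

Definition torsion (D : deriv_op) (X Y : vfield) : pifield :=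
  D X (rho Y) \- D Y (rho X) \- rho (lie_bracket tatlas X Y).

Definition hh_torsion (D : connection) (X Y : pifield) : pifield :=
  torsion (conn_op D) (beta D X) (beta D Y).

Definition hv_torsion (D : connection) (X Y : pifield) : pifield :=
  torsion (conn_op D) (gamma X) (beta D Y).

(* With the sign convention opposite to the usual one. *)
Definition curvature (D : deriv_op) (X Y : vfield) (Z : pifield) : pifield :=
  D Y (D X Z) \- D X (D Y Z) \+ D (lie_bracket tatlas X Y) Z.

(* The h-, hv- and v-curvature tensors of [D]; the first argument is the lift
   beta. *)
Definition h_curvature (b : pifield -> vfield) (D : deriv_op)
    (X Y Z : pifield) : pifield := curvature D (b X) (b Y) Z.
Definition hv_curvature (b : pifield -> vfield) (D : deriv_op)
    (X Y Z : pifield) : pifield := curvature D (b X) (gamma Y) Z.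
Definition v_curvature (D : deriv_op) (X Y Z : pifield) : pifield :=
  curvature D (gamma X) (gamma Y) Z.

(* g_u(v, w) = (1/2) d^2/ds dt L^2(u + s v + t w) at s = t = 0. *)
Definition finsler_metric (L : TM -> R) (u : TM) (v w : 'rV[R]_n) : R :=
  2^-1 * 'D_v ('D_w (fun y : 'rV[R]_n => L (TVec (base u) y) ^+ 2 : R)) (vec u).

Record finsler_structure (L : TM -> R) : Prop := {
  finsler_smooth : forall u, slit u -> smooth_at tatlas L u;
  finsler_pos : forall u, slit u -> 0 < L u;
  finsler_homog : forall x y (a : R), 0 <= a ->
    L (TVec x (a *: y)) = a * L (TVec x y);
  finsler_posdef : forall u v, slit u -> v != 0 -> 0 < finsler_metric L u v v }.

Record cartan_connection (L : TM -> R) (D : connection) : Prop := {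
  cartan_linear : linear_connection D;
  cartan_regular : regular D;
  cartan_metric : forall X Y Z,
    smooth_vfield X -> smooth_pifield Y -> smooth_pifield Z ->
    forall u, slit u ->
    dir_deriv tatlas (fun w => finsler_metric L w (Y w) (Z w)) u (X u) =
      finsler_metric L u (conn_op D X Y u) (Z u)
      + finsler_metric L u (Y u) (conn_op D X Z u);
  cartan_hh : forall X Y, smooth_pifield X -> smooth_pifield Y ->
    forall u, slit u -> hh_torsion D X Y u = 0;
  cartan_hv : forall X Y Z,
    smooth_pifield X -> smooth_pifield Y -> smooth_pifield Z ->
    forall u, slit u ->
    finsler_metric L u (hv_torsion D X Y u) (Z u) =
      finsler_metric L u (hv_torsion D X Z u) (Y u) }.

(* The Chern connection attached to the Cartan connection [D]. *)
Definition chern (D : connection) : deriv_op :=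
  fun X Y => conn_op D X Y \- hv_torsion D (Kmap D X) Y.

Definition conformally_related (sigma : M -> R) (L Lt : TM -> R) : Prop :=
  forall u v w, slit u ->
    finsler_metric Lt u v w =
      expR (2 * sigma (base u)) * finsler_metric L u v w.

(* In the following definitions, D and Dt are the Cartan connections of (M, L)
   and of the conformally related (M, Lt). *)
Definition Nmap (D Dt : connection) (X : pifield) : pifield :=
  conn_op Dt (beta D X) eta \- conn_op D (beta D X) eta.

Definition Bc (D Dt : connection) (X Y : pifield) : pifield :=
  chern Dt (beta D X) Y \- chern D (beta D X) Y.

(* (D_X B)(Y, Z) *)
Definition cov_deriv2 (D : deriv_op) (X : vfield)
    (B : pifield -> pifield -> pifield) (Y Z : pifield) : pifield :=
  D X (B Y Z) \- B (D X Y) Z \- B Y (D X Z).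

End PullbackBundle.

Definition antisym {R : realType} {M : Type} {n : nat} {A : atlas R M n}
    (F : pifield A -> pifield A -> pifield A) (X Y : pifield A) : pifield A :=
  F X Y \- F Y X.

(* Main.v *)
(* In the fibre T_xM the vertical derivative [vd] is the flat derivative of R^n.
   Metric compatibility, symmetry of the hv-torsion and homogeneity of L^2 give
   K (gamma V) = V for a Cartan connection; hence its Chern connection is [vd]
   along vertical fields, so that S^c = 0 by the symmetry of second derivatives,
   and it is torsion-free. The difference of the two Chern connections vanishes on
   vertical fields, so it is Dct_X Y = Dc_X Y + B (rho X, Y), and torsion-freeness
   yields, for all fields X, X' on the slit tangent bundle,
     Kt(X, X') Z = K(X, X') Z - (D_X B)(rho X', Z) + (D_X' B)(rho X, Z)
                   - B(rho X, B(rho X', Z)) + B(rho X', B(rho X, Z)).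
   It remains to insert the lifts betat X = beta X - gamma (N X) and gamma Y. *)

Require Import Defs.
From HB Require Import structures.
From mathcomp Require Import all_boot all_order all_algebra.
From mathcomp Require Import all_classical all_reals all_analysis.
From mathcomp Require Import ring lra.
Import Defs.
Set Implicit Arguments.
Unset Strict Implicit.
Unset Printing Implicit Defensive.
Import Order.TTheory GRing.Theory Num.Theory.
Import numFieldNormedType.Exports.
Local Open Scope classical_set_scope.
Local Open Scope ring_scope.

(** * Calculus of smooth functions *)

(** Tangent vectors at p are stored in the chart [chart_at A p], which may jump from point to point,
    and every object on TM is a total function meaningful only over [slit]. Hence derivatives are
    transported to one fixed chart, equalities of sections are claimed on [slit] only, and operators
    must be shown to depend only on values there. Curvature iterates covariant derivatives, so each
    intermediate section has to be smooth; the serious case is [beta D Y], which is picked pointwise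
    by [xget] and becomes smooth through an explicit matrix inverse. Positivity of g enters in K
    (gamma V) = V: the section T(V, eta) has zero g-length. That identity makes X - gamma (K X) the
    horizontal part of X, which is what allows the Chern connection, its torsion and the change of
    connection to be treated separately on vertical and horizontal fields; the relation between beta
    and betat is this same splitting for the second connection. *)

Section Differentiability.
Context {R : realType}.

(** The differential is determined by the first-order expansion, which involves only values near a,
    so [diff_unique] transfers it from f to g. *)
Lemma near_eq_differentiable (V W : normedModType R) (f g : V -> W) (a : V) :
  (\near a, f a = g a) -> differentiable f a -> differentiable g a /\ 'd g a = 'd f a :> (V -> W).
Proof.
move=> fg df.
have ga : g a = f a by rewrite (nbhs_singleton fg).
have H : g \o shift a = cst (g a) + 'd f a +o_ (nbhs (0:V)) id.
  apply/eqaddoP => eps e0.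
  have /eqaddoP /(_ _ e0) := diff_locally df.
  have fg0 : \forall z \near (0:V), f (z + a) = g (z + a).
    by have := fg; rewrite [X in X -> _](near_shift 0) /= subr0.
  apply: filterS2 fg0.
  move=> x /= fgx; rewrite !fctE /= -fgx ga; exact.
have E : 'd g a = 'd f a :> (V -> W).
  by have [c _] := (diff_locallyP a f).1 df; apply: diff_unique c H.
split => //; apply/diff_locallyP; rewrite E; split => //.
by have [] := (diff_locallyP a f).1 df.
Qed.

Lemma derive_comp (U V W : normedModType R) (f : U -> V) (g : V -> W) x v :
  differentiable f x -> differentiable g (f x) ->
  'D_v (g \o f) x = 'D_('D_v f x) g (f x).
Proof.
move=> df dg; have dfg : differentiable (g \o f) x by exact: differentiable_comp.
by rewrite (deriveE _ dfg) (deriveE _ df) (deriveE _ dg) diff_comp.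
Qed.

Lemma derive_dirD (V W : normedModType R) (f : V -> W) x v w :
  differentiable f x -> 'D_(v + w) f x = 'D_v f x + 'D_w f x.
Proof. by move=> df; rewrite !(deriveE _ df) linearD. Qed.

Lemma derive_dirB (V W : normedModType R) (f : V -> W) x v w :
  differentiable f x -> 'D_(v - w) f x = 'D_v f x - 'D_w f x.
Proof. by move=> df; rewrite !(deriveE _ df) linearB. Qed.

Lemma derive_dirZ (V W : normedModType R) (f : V -> W) x k v :
  differentiable f x -> 'D_(k *: v) f x = k *: 'D_v f x.
Proof. by move=> df; rewrite !(deriveE _ df) linearZ. Qed.

Lemma derive_row_sum m (W : normedModType R) (f : 'rV[R]_m -> W) x v :
  differentiable f x -> 'D_v f x = \sum_j v 0 j *: 'D_('e_j) f x.
Proof.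
move=> df; rewrite (deriveE _ df) {1}(row_sum_delta v) linear_sum.
by apply: eq_bigr => j _; rewrite linearZ (deriveE _ df).
Qed.

Lemma derive_entry m (V : normedModType R) (f : V -> 'rV[R]_m) x v j :
  derivable f x v -> ('D_v f x) 0 j = 'D_v (fun y => f y 0 j) x.
Proof. by move=> df; rewrite derive_mx // mxE. Qed.

Lemma differentiable_entry m (V : normedModType R) (f : V -> 'rV[R]_m) x j :
  differentiable f x -> differentiable (fun y => f y 0 j) x.
Proof.
move=> df; apply: (@differentiable_comp _ _ _ _ f (fun M : 'rV[R]_m => M 0 j : R)) => //.
exact: differentiable_coord.
Qed.

Lemma differentiable_rowP m (V : normedModType R) (f : V -> 'rV[R]_m) x :
  (forall j, differentiable (fun y => f y 0 j) x) -> differentiable f x.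
Proof.
move=> df.
have -> : f = \sum_(j < m) (fun y => f y 0 j *: 'e_j).
  by apply/funext => y; rewrite fct_sumE [LHS]row_sum_delta.
by apply: differentiable_sum => j; exact: differentiableZl.
Qed.

End Differentiability.

Section Ck_calculus.
Context {R : realType}.
Implicit Types (V W : normedModType R).

(** Openness of U turns equality on U into equality near each of its points, so the directional
    derivatives agree on U as well and the induction continues. *)
Lemma Ck_ext V W k (U : set V) (f g : V -> W) : open U ->
  (forall x, U x -> f x = g x) -> Ck k U f -> Ck k U g.
Proof.
move=> oU; elim: k f g => [|k IH] f g fg /=.
  move=> cf x Ux; have nU : nbhs x U by exact: open_nbhs_nbhs.
  have E : \near x, f x = g x by apply: filterS nU => y; exact: fg.
  change (g y @[y --> x] --> g x); rewrite -(fg _ Ux).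
  apply: cvg_trans (cf _ Ux); exact: near_eq_cvg.
move=> [df cf]; split.
  move=> x Ux; have nU : nbhs x U by exact: open_nbhs_nbhs.
  have E : \near x, f x = g x by apply: filterS nU => y; exact: fg.
  by have [] := near_eq_differentiable E (df _ Ux).
move=> v; apply: IH (cf v) => x Ux; apply: near_eq_derive.
have nU : nbhs x U by exact: open_nbhs_nbhs.
by apply: filterS nU => y; exact: fg.
Qed.

Lemma Ck_sub V W k (U U' : set V) (f : V -> W) :
  U' `<=` U -> Ck k U f -> Ck k U' f.
Proof.
move=> UU; elim: k f => [|k IH] f /=; first by move=> c x /UU; exact: c.
by move=> [d c]; split => [x /UU|v]; [exact: d|exact/IH/c].
Qed.

Lemma CkS V W k (U : set V) (f : V -> W) : Ck k.+1 U f -> Ck k U f.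
Proof.
elim: k f => [|k IH] f.
  by move=> [d _] x Ux; apply/differentiable_continuous/d.
by move=> [d c]; split => // v; exact/IH/c.
Qed.

Lemma Ck_cst V W k (U : set V) (a : W) : Ck k U (cst a).
Proof.
elim: k a => [|k IH] a /=; first by move=> x _; exact: cst_continuous.
split => [x _|v]; first exact: differentiable_cst.
have -> : 'D_v (cst a) = cst (0 : W) by apply/funext => x; rewrite derive_cst.
exact: IH.
Qed.

Lemma CkD V W k (U : set V) (f g : V -> W) : open U ->
  Ck k U f -> Ck k U g -> Ck k U (f \+ g).
Proof.
move=> oU; elim: k f g => [|k IH] f g /=.
  by move=> cf cg x Ux; apply: continuousD; [exact: cf|exact: cg].
move=> [df cf] [dg cg]; split => [x Ux|v].
  by apply: differentiableD; [exact: df|exact: dg].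
apply: (@Ck_ext _ _ _ _ ('D_v f \+ 'D_v g)) => // [x Ux|].
  by rewrite deriveD //; apply: diff_derivable; [exact: df|exact: dg].
by apply: IH; [exact: cf|exact: cg].
Qed.

Lemma CkM V k (U : set V) (f g : V -> R) : open U ->
  Ck k U f -> Ck k U g -> Ck k U (f \* g).
Proof.
move=> oU; elim: k f g => [|k IH] f g.
  by move=> cf cg x Ux; apply: continuousM; [exact: cf|exact: cg].
move=> Hf Hg; have := (Hf, Hg) => -[[df cf] [dg cg]]; split => [x Ux|v].
  by apply: differentiableM; [exact: df|exact: dg].
apply: (@Ck_ext _ _ _ _ ((f \* 'D_v g) \+ (g \* 'D_v f))) => // [x Ux|].
  by rewrite deriveM //; apply: diff_derivable; [exact: df|exact: dg].
by apply: CkD => //; apply: IH; [exact: CkS|exact: cg|exact: CkS|exact: cf].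
Qed.

(** The derivative is -(1/f)^2 'D_v f, in which 1/f is needed only at class k; the induction
    hypothesis provides that. *)
Lemma CkV V k (U : set V) (f : V -> R) : open U -> (forall x, U x -> f x != 0) ->
  Ck k U f -> Ck k U (fun x => (f x)^-1).
Proof.
move=> oU f0; elim: k f f0 => [|k IH] f f0.
  by move=> cf x Ux; apply: continuousV; [exact: f0|exact: cf].
move=> Hf; have [df cf] := Hf; split => [x Ux|v].
  by apply: differentiableV; [exact: df|exact: f0].
apply: (@Ck_ext _ _ _ _ ((fun x => cst (-1) x * ((f x)^-1 * (f x)^-1)) \* 'D_v f)) => // [x Ux|].
  rewrite deriveV //; [|exact: f0|exact/diff_derivable/df].
  by rewrite /= /cst mulN1r -invfM -expr2.
apply: CkM => //; last exact: cf.
apply: (@CkM _ k U (cst (-1)) (fun x => (f x)^-1 * (f x)^-1)) => //.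
  exact: Ck_cst.
by apply: (@CkM _ k U (fun x => (f x)^-1)) => //; apply: IH => //; exact: CkS.
Qed.

Lemma Ck_coord m k (U : set 'rV[R]_m) j : Ck k U (fun x : 'rV[R]_m => x 0 j).
Proof.
case: k => [|k] /=; first by move=> x _; exact: matrix_normedtype.coord_continuous.
split => [x _|v]; first exact: differentiable_coord.
have -> : 'D_v (fun x : 'rV[R]_m => x 0 j) = cst (v 0 j).
  apply/funext => x; have /derive_entry <- : derivable (@id 'rV[R]_m) x v.
    exact: derivable_id.
  by rewrite derive_id.
exact: Ck_cst.
Qed.

Lemma Ck_entry m V k (U : set V) (f : V -> 'rV[R]_m) j : open U ->
  Ck k U f -> Ck k U (fun x => f x 0 j).
Proof.
move=> oU; elim: k f => [|k IH] f /=.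
  move=> cf x Ux; apply: (@continuous_comp _ _ _ f (fun y : 'rV[R]_m => y 0 j)).
    exact: cf.
  exact: matrix_normedtype.coord_continuous.
move=> [df cf]; split => [x Ux|v]; first exact/differentiable_entry/df.
apply: (@Ck_ext _ _ _ _ (fun x => 'D_v f x 0 j)) => // [x Ux|].
  by rewrite derive_entry //; exact/diff_derivable/df.
exact: IH.
Qed.

Lemma Ck_row m V k (U : set V) (f : V -> 'rV[R]_m) : open U ->
  (forall j, Ck k U (fun x => f x 0 j)) -> Ck k U f.
Proof.
move=> oU; elim: k f => [|k IH] f /= Hf.
  move=> x Ux; have -> : f = (fun y => \sum_(j < m) f y 0 j *: 'e_j).
    by apply/funext => y; rewrite [LHS]row_sum_delta.
  apply: cvg_big => [|j _]; first exact: add_continuous.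
  by apply: cvgZr_tmp; exact: Hf.
have df x : U x -> differentiable f x.
  by move=> Ux; apply: differentiable_rowP => j; have [d _] := Hf j; exact: d.
split => // v; apply: IH => j.
apply: (@Ck_ext _ _ _ _ ('D_v (fun x => f x 0 j))) => // [x Ux|].
  by rewrite derive_entry //; exact/diff_derivable/df.
by have [_] := Hf j; exact.
Qed.

(** The derivative of a in direction v does not depend on the point, so differentiating f \o a gives
    ('D_(l v) f) \o a, again of the same form. This covers the insertions y |-> (x, y) and the
    projection (x, y) |-> x. *)
Lemma Ck_affine V V' W k (U : set V') (f : V' -> W) (a l : V -> V') : open U ->
  (forall x, differentiable a x) -> (forall x v, 'D_v a x = l v) ->
  Ck k U f -> Ck k (a @^-1` U) (f \o a).
Proof.
move=> oU da Da.
have oaU : open (a @^-1` U).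
  by apply: open_comp => // x _; exact/differentiable_continuous/da.
elim: k f => [|k IH] f /=.
  move=> cf x Ux; apply: continuous_comp; last exact: cf.
  exact/differentiable_continuous/da.
move=> [df cf]; split => [x Ux|v].
  by apply: differentiable_comp => //; exact: df.
apply: (@Ck_ext _ _ _ _ ('D_(l v) f \o a)) => // [x Ux|]; last exact/IH/cf.
by rewrite derive_comp ?Da //; exact: df.
Qed.

End Ck_calculus.

Section Cinfty_calculus.
Context {R : realType}.
Implicit Types (V W : normedModType R).

Lemma Cinfty_ext V W (U : set V) (f g : V -> W) : open U ->
  (forall x, U x -> f x = g x) -> Cinfty U f -> Cinfty U g.
Proof. by move=> oU fg cf k; exact: Ck_ext fg _. Qed.

Lemma Cinfty_sub V W (U U' : set V) (f : V -> W) :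
  U' `<=` U -> Cinfty U f -> Cinfty U' f.
Proof. by move=> UU cf k; exact: Ck_sub (cf k). Qed.

Lemma Cinfty_differentiable V W (U : set V) (f : V -> W) x :
  Cinfty U f -> U x -> differentiable f x.
Proof. by move=> /(_ 1%N)[df _]; exact: df. Qed.

Lemma Cinfty_derive V W (U : set V) (f : V -> W) v :
  Cinfty U f -> Cinfty U ('D_v f).
Proof. by move=> cf k; have [_] := cf k.+1; exact. Qed.

Lemma Cinfty_cst V W (U : set V) (a : W) : Cinfty U (cst a).
Proof. by move=> k; exact: Ck_cst. Qed.

Lemma CinftyD V W (U : set V) (f g : V -> W) : open U ->
  Cinfty U f -> Cinfty U g -> Cinfty U (f \+ g).
Proof. by move=> oU cf cg k; exact: CkD. Qed.

Lemma CinftyM V (U : set V) (f g : V -> R) : open U ->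
  Cinfty U f -> Cinfty U g -> Cinfty U (f \* g).
Proof. by move=> oU cf cg k; exact: CkM. Qed.

Lemma CinftyV V (U : set V) (f : V -> R) : open U ->
  (forall x, U x -> f x != 0) -> Cinfty U f -> Cinfty U (fun x => (f x)^-1).
Proof. by move=> oU f0 cf k; exact: CkV. Qed.

Lemma Cinfty_coord m (U : set 'rV[R]_m) j :
  Cinfty U (fun x : 'rV[R]_m => x 0 j).
Proof. by move=> k; exact: Ck_coord. Qed.

Lemma Cinfty_rowP m V (U : set V) (f : V -> 'rV[R]_m) : open U ->
  Cinfty U f <-> forall j, Cinfty U (fun x => f x 0 j).
Proof.
by move=> oU; split => [cf j k|cf k]; [exact: Ck_entry|apply: Ck_row => // j; exact: cf].
Qed.

Lemma Cinfty_affine V V' W (U : set V') (f : V' -> W) (a l : V -> V') :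
  open U -> (forall x, differentiable a x) -> (forall x v, 'D_v a x = l v) ->
  Cinfty U f -> Cinfty (a @^-1` U) (f \o a).
Proof. by move=> oU da Da cf k; exact: Ck_affine Da (cf k). Qed.

Lemma Cinfty_sum V W (I : Type) (r : seq I) (P : pred I) (U : set V)
  (F : I -> V -> W) : open U -> (forall i, Cinfty U (F i)) ->
  Cinfty U (fun x => \sum_(i <- r | P i) F i x).
Proof.
move=> oU cF; elim: r => [|i r IH].
  by under eq_fun do rewrite big_nil; exact: Cinfty_cst.
under eq_fun do rewrite big_cons.
by case: (P i) => //; exact: CinftyD.
Qed.

Lemma Cinfty_prod V (I : Type) (r : seq I) (P : pred I) (U : set V)
  (F : I -> V -> R) : open U -> (forall i, Cinfty U (F i)) ->
  Cinfty U (fun x => \prod_(i <- r | P i) F i x).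
Proof.
move=> oU cF; elim: r => [|i r IH].
  by under eq_fun do rewrite big_nil; exact: Cinfty_cst.
under eq_fun do rewrite big_cons.
by case: (P i) => //; exact: CinftyM.
Qed.

Lemma CinftyZ V m (U : set V) (f : V -> R) (g : V -> 'rV[R]_m) : open U ->
  Cinfty U f -> Cinfty U g -> Cinfty U (fun x => f x *: g x).
Proof.
move=> oU cf /(Cinfty_rowP _ oU) cg; apply/Cinfty_rowP => // j.
by under eq_fun do rewrite mxE; exact: CinftyM.
Qed.

Lemma CinftyN V m (U : set V) (f : V -> 'rV[R]_m) : open U ->
  Cinfty U f -> Cinfty U (fun x => - f x).
Proof.
move=> oU cf; under eq_fun do rewrite -scaleN1r.
by apply: (@CinftyZ _ _ _ (cst (-1))) => //; exact: Cinfty_cst.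
Qed.

Lemma CinftyB V m (U : set V) (f g : V -> 'rV[R]_m) : open U ->
  Cinfty U f -> Cinfty U g -> Cinfty U (f \- g).
Proof. by move=> oU cf cg; apply: CinftyD => //; exact: CinftyN. Qed.

Lemma Cinfty_row_mx V m1 m2 (U : set V) (f : V -> 'rV[R]_m1) (g : V -> 'rV[R]_m2) :
  open U -> Cinfty U f -> Cinfty U g -> Cinfty U (fun x => row_mx (f x) (g x)).
Proof.
move=> oU /(Cinfty_rowP _ oU) cf /(Cinfty_rowP _ oU) cg.
apply/Cinfty_rowP => // j; under eq_fun do rewrite mxE.
by case: (fintype.split j) => i; [exact: cf|exact: cg].
Qed.

Lemma Cinfty_lsubmx V m1 m2 (U : set V) (f : V -> 'rV[R]_(m1 + m2)) :
  open U -> Cinfty U f -> Cinfty U (fun x => lsubmx (f x)).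
Proof.
move=> oU /(Cinfty_rowP _ oU) cf; apply/Cinfty_rowP => // j.
under eq_fun do rewrite mxE; exact: cf.
Qed.

Lemma Cinfty_rsubmx V m1 m2 (U : set V) (f : V -> 'rV[R]_(m1 + m2)) :
  open U -> Cinfty U f -> Cinfty U (fun x => rsubmx (f x)).
Proof.
move=> oU /(Cinfty_rowP _ oU) cf; apply/Cinfty_rowP => // j.
under eq_fun do rewrite mxE; exact: cf.
Qed.

(** The direction varies with the point, so [Cinfty_derive] does not apply directly; expanding X in
    the standard basis leaves fixed directions with smooth coefficients. *)
Lemma Cinfty_derive_along m p (U : set 'rV[R]_m) (f : 'rV[R]_m -> 'rV[R]_p)
  (X : 'rV[R]_m -> 'rV[R]_m) : open U -> Cinfty U f -> Cinfty U X ->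
  Cinfty U (fun x => 'D_(X x) f x).
Proof.
move=> oU cf /(Cinfty_rowP _ oU) cX.
apply: (@Cinfty_ext _ _ _ (fun x => \sum_j X x 0 j *: 'D_('e_j) f x)) => // [x Ux|].
  by rewrite [RHS]derive_row_sum //; exact: Cinfty_differentiable cf Ux.
apply: Cinfty_sum => // j; apply: CinftyZ => //; exact: Cinfty_derive.
Qed.

Lemma Cinfty_derive_along_real m (U : set 'rV[R]_m) (f : 'rV[R]_m -> R)
  (X : 'rV[R]_m -> 'rV[R]_m) : open U -> Cinfty U f -> Cinfty U X ->
  Cinfty U (fun x => 'D_(X x) f x).
Proof.
move=> oU cf /(Cinfty_rowP _ oU) cX.
apply: (@Cinfty_ext _ _ _ (fun x => \sum_j X x 0 j * 'D_('e_j) f x)) => // [x Ux|].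
  by apply: esym; exact: derive_row_sum (Cinfty_differentiable cf Ux).
apply: Cinfty_sum => // j; apply: CinftyM => //; exact: Cinfty_derive.
Qed.

Lemma Cinfty_det V m (U : set V) (A : V -> 'M[R]_m) : open U ->
  (forall i j, Cinfty U (fun x => A x i j)) -> Cinfty U (fun x => \det (A x)).
Proof.
move=> oU cA; rewrite /determinant.
apply: Cinfty_sum => // s.
apply: (CinftyM oU (Cinfty_cst _ _)).
exact: Cinfty_prod.
Qed.

(** Cramer's rule: the entries are cofactors over the determinant, which does not vanish on U. *)
Lemma Cinfty_invmx V m (U : set V) (A : V -> 'M[R]_m) : open U ->
  (forall x, U x -> A x \in unitmx) ->
  (forall i j, Cinfty U (fun x => A x i j)) ->
  forall i j, Cinfty U (fun x => invmx (A x) i j).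
Proof.
move=> oU uA cA i j.
apply: (@Cinfty_ext _ _ _
  (fun x => (\det (A x))^-1 * ((-1) ^+ (j + i) * \det (row' j (col' i (A x)))))) => //.
  by move=> x Ux; rewrite /invmx (uA _ Ux) !mxE.
apply: (@CinftyM _ _ (fun x => (\det (A x))^-1)) => //.
  apply: CinftyV => //; last exact: Cinfty_det.
  by move=> x /uA; rewrite unitmxE unitfE.
apply: (CinftyM oU (Cinfty_cst _ _)).
apply: Cinfty_det => // i' j'; under eq_fun do rewrite !mxE; exact: cA.
Qed.

Lemma Cinfty_mulmx V m p (U : set V) (f : V -> 'rV[R]_m) (A : V -> 'M[R]_(m, p)) :
  open U -> Cinfty U f -> (forall i j, Cinfty U (fun x => A x i j)) ->
  Cinfty U (fun x => f x *m A x).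
Proof.
move=> oU /(Cinfty_rowP _ oU) cf cA; apply/Cinfty_rowP => // j.
under eq_fun do rewrite mxE.
by apply: Cinfty_sum => // i; exact: CinftyM.
Qed.

End Cinfty_calculus.

(** * Symmetry of mixed second derivatives *)

Section Schwarz.
Context {R : realType} {V : normedModType R}.

Lemma is_derive_line (W : normedModType R) (f : V -> W) (c v : V) (s : R) :
  differentiable f (c + s *: v) ->
  is_derive s 1 (fun t : R => f (c + t *: v)) ('D_v f (c + s *: v)).
Proof.
move=> df; pose a (t : R) := c + t *: v.
have da : differentiable a s.
  by apply: differentiableD; [exact: differentiable_cst|exact: differentiableZl].
have Da : 'D_1 a s = v.
  have -> : a = cst c + (fun t : R => t *: v) by [].
  rewrite deriveD //.
    rewrite derive_cst add0r deriveE; last exact: differentiableZl.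
    by rewrite diffZl // diff_val scale1r.
  exact/diff_derivable/differentiableZl.
apply: DeriveDef; first by apply/diff_derivable/(@differentiable_comp _ _ _ _ a f).
by have := derive_comp (f := a) 1 da df; rewrite Da.
Qed.

Lemma MVT_line (g : V -> R) (c v : V) (h : R) : 0 <= h ->
  (forall s, 0 <= s <= h -> differentiable g (c + s *: v)) ->
  exists2 s, 0 <= s <= h & g (c + h *: v) - g c = 'D_v g (c + s *: v) * h.
Proof.
move=> h0 dg.
have d1 s : s \in `]0, h[ ->
    is_derive s 1 (fun t : R => g (c + t *: v)) ('D_v g (c + s *: v)).
  rewrite in_itv /= => /andP[s0 sh].
  by apply: is_derive_line; apply: dg; rewrite !ltW.
have c1 : {within `[0, h], continuous (fun t : R => g (c + t *: v))}.
  apply: derivable_within_continuous => s; rewrite in_itv /= => sh.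
  by have [] := is_derive_line (dg _ sh).
have [s] := MVT_segment h0 d1 c1.
by rewrite in_itv /= scale0r addr0 subr0 => sh E; exists s.
Qed.

(** The mean value theorem is used twice: in direction v for y |-> f(y + h w) - f(y), then in
    direction w for the resulting increment of 'D_v f. *)
Lemma second_difference (U : set V) (f : V -> R) x v w (h : R) :
  0 <= h -> Ck 2 U f ->
  (forall s t, 0 <= s <= h -> 0 <= t <= h -> U (x + s *: v + t *: w)) ->
  exists s t, [/\ 0 <= s <= h, 0 <= t <= h &
    f (x + h *: v + h *: w) - f (x + h *: v) - (f (x + h *: w) - f x) =
    'D_w ('D_v f) (x + s *: v + t *: w) * h * h].
Proof.
move=> h0 [df /(_ v)[ddf _]] Uxh.
have hh : 0 <= h <= h by rewrite lexx h0.
have oo : 0 <= (0 : R) <= h by rewrite lexx h0.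
have dshift y : U (y + h *: w) -> differentiable (fun z => f (z + h *: w)) y /\
    'D_v (fun z => f (z + h *: w)) y = 'D_v f (y + h *: w).
  move=> Uy; have dy : differentiable (fun z => z + h *: w) y by exact: differentiableD.
  split; first exact: (@differentiable_comp _ _ _ _ (fun z => z + h *: w) f) _ (df _ Uy).
  rewrite (@derive_comp _ _ _ _ (fun z => z + h *: w) f) //; last exact: df.
  by rewrite deriveD // derive_id derive_cst addr0.
pose g (y : V) := f (y + h *: w) - f y.
have dg s : 0 <= s <= h -> differentiable g (x + s *: v).
  move=> sh; apply: differentiableB.
    by apply: (dshift _ _).1; exact: Uxh.
  by apply: df; rewrite -[_ + _]addr0 -(scale0r w); exact: Uxh.
have [s sh Es] := MVT_line h0 dg.
have [t th Et] : exists2 t, 0 <= t <= h &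
    'D_v f (x + s *: v + h *: w) - 'D_v f (x + s *: v) =
    'D_w ('D_v f) (x + s *: v + t *: w) * h.
  apply: (MVT_line (g := 'D_v f) h0) => t th; apply: ddf; exact: Uxh.
exists s, t; split => //; rewrite -Et.
rewrite -/(g (x + h *: v)) -/(g x) Es; congr (_ * _).
have Us0 : U (x + s *: v) by rewrite -[_ + _]addr0 -(scale0r w); exact: Uxh.
have [d1 D1] := dshift _ (Uxh _ _ sh hh).
by rewrite deriveB ?D1 //; apply: diff_derivable => //; exact: df.
Qed.

(** The second difference of f over the parallelogram spanned by h v and h w is symmetric in v and
    w. Evaluated in both orders by [second_difference], it equals h^2 times either mixed derivative
    at some nearby point; continuity then forces their values at x to be within any e of each
    other. *)
Theorem derive_symmetric (U : set V) (f : V -> R) x v w : open U ->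
  Ck 2 U f -> U x -> 'D_w ('D_v f) x = 'D_v ('D_w f) x.
Proof.
move=> oU cf Ux; apply/eqP; rewrite -subr_eq0 -normr_eq0; apply/eqP.
apply: le_anti; rewrite normr_ge0 andbT; apply/ler_addgt0Pr => e e0; rewrite add0r.
have cD v' w' : {for x, continuous ('D_w' ('D_v' f))}.
  by have [_ /(_ v')[_ /(_ w')]] := cf; exact.
have e2 : 0 < e / 2 by rewrite divr_gt0.
have nU : nbhs x U by exact: open_nbhs_nbhs.
have near_cont (F : V -> R) : {for x, continuous F} ->
    \forall z \near x, `|F x - F z| <= e / 2.
  by move=> cF; have /cvgrPdist_le := cF; apply.
have : \forall z \near x, [/\ U z, `|'D_w ('D_v f) x - 'D_w ('D_v f) z| <= e / 2 &
   `|'D_v ('D_w f) x - 'D_v ('D_w f) z| <= e / 2].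
  apply: filterS3 nU (near_cont _ (cD v w)) (near_cont _ (cD w v)) => z a b c.
  exact: And3 a b c.
move=> /nbhs_ballP[d /= d0 Hd].
(* The summand 1 keeps C positive when v = w = 0; with h = d / (2C), the two sides together have
   length less than d, so the parallelogram stays in the ball. *)
pose C := `|v| + `|w| + 1.
have C0 : 0 < C by rewrite ltr_wpDl // addr_ge0.
pose h := d / (C * 2).
have h0 : 0 < h by rewrite divr_gt0 // mulr_gt0.
have Bd s t : 0 <= s <= h -> 0 <= t <= h -> ball x d (x + s *: v + t *: w).
  move=> /andP[s0 sh] /andP[t0 th]; rewrite -ball_normE /ball_ /=.
  rewrite -addrA opprD addNKr normrN (le_lt_trans (ler_normD _ _)) //.
  rewrite !normrZ !ger0_norm //.
  have : s * `|v| + t * `|w| <= h * (`|v| + `|w|).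
    by rewrite mulrDr lerD // ler_wpM2r.
  move=> /le_lt_trans; apply.
  have : h * (`|v| + `|w|) < h * (C * 2).
    rewrite ltr_pM2l //; have : `|v| + `|w| < C by rewrite ltrDl.
    move=> /lt_le_trans; apply; rewrite ler_peMr ?ltW // ?ler1n //.
    by rewrite -[1]/(1%:R) ltr_nat.
  by move=> /lt_le_trans; apply; rewrite /h divfK // mulf_neq0 // gt_eqF.
have [s [t [sh th E1]]] := @second_difference U f x v w h (ltW h0) cf
  (fun s t sh th => let: And3 a _ _ := Hd _ (Bd s t sh th) in a).
have Bd' s' t' : 0 <= s' <= h -> 0 <= t' <= h -> ball x d (x + s' *: w + t' *: v).
  by move=> sh' th'; rewrite addrAC; exact: Bd.
have [s' [t' [sh' th' E2]]] := @second_difference U f x w v h (ltW h0) cf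
  (fun s t sh th => let: And3 a _ _ := Hd _ (Bd' s t sh th) in a).
have [_ A1 _] := Hd _ (Bd _ _ sh th).
have [_ _ A2] := Hd _ (Bd' _ _ sh' th').
have comm : f (x + h *: v + h *: w) - f (x + h *: v) - (f (x + h *: w) - f x) =
    f (x + h *: w + h *: v) - f (x + h *: w) - (f (x + h *: v) - f x).
  rewrite (addrAC x (h *: w)).
  move: (f _) (f _) (f _) (f _) => a1 a2 a3 a4; by rewrite !opprD !opprK !addrA (addrAC a4).
move: E1 E2 A1 A2; rewrite comm => ->.
move: ('D_w ('D_v f) (x + s *: v + t *: w)) ('D_v ('D_w f) (x + s' *: w + t' *: v)).
move: ('D_w ('D_v f) x) ('D_v ('D_w f) x) => p q a b.
move=> /(mulIf (lt0r_neq0 h0)) /(mulIf (lt0r_neq0 h0)) -> A1 A2.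
have -> : p - q = (p - b) + (b - q) by rewrite subrKA.
rewrite (splitr e); apply: (le_trans (ler_normD _ _)); apply: lerD; first exact: A1.
by rewrite distrC.
Qed.

End Schwarz.

Lemma derive_symmetric_row {R : realType} {V : normedModType R} m (U : set V)
    (f : V -> 'rV[R]_m) x v w : open U ->
  Cinfty U f -> U x -> 'D_w ('D_v f) x = 'D_v ('D_w f) x.
Proof.
move=> oU cf Ux; have nU : nbhs x U by exact: open_nbhs_nbhs.
have dd v' w' j : ('D_w' ('D_v' f) x) 0 j = 'D_w' ('D_v' (fun y => f y 0 j)) x.
  rewrite derive_entry.
    apply: near_eq_derive; apply: filterS nU => y Uy; rewrite derive_entry //.
    exact/diff_derivable/(Cinfty_differentiable cf Uy).
  exact/diff_derivable/(Cinfty_differentiable (Cinfty_derive v' cf) Ux).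
apply/rowP => j; apply: etrans (dd v w j) (etrans _ (esym (dd w v j))).
exact: (derive_symmetric v w oU ((Cinfty_rowP f oU).1 cf j 2%N) Ux).
Qed.

Lemma addrKB (V : zmodType) (x y z : V) : (x + z) - (y + z) = x - y.
Proof. by rewrite opprD addrACA subrr addr0. Qed.

Lemma subrDACA (V : zmodType) (x y z t : V) : (x + y) - (z + t) = (x - z) + (y - t).
Proof. by rewrite opprD addrACA. Qed.

Lemma subrBACA (V : zmodType) (x y z t : V) : (x - y) - (z - t) = (x - z) - (y - t).
Proof. by rewrite subrDACA opprB -opprD opprB. Qed.

Section DeriveAlong.
Context {R : realType} {m : nat}.

(** Product rule for the pairing of Y with df: the terms where df is differentiated are Y^j 'D_w
    ('D_(e_j) f), and symmetry of second derivatives moves e_j outside, so that they add up to the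
    derivative of 'D_w f along Y. *)
Lemma derive_along_real (U : set 'rV[R]_m) (f : 'rV[R]_m -> R)
    (Y : 'rV[R]_m -> 'rV[R]_m) (z w : 'rV[R]_m) : open U -> U z ->
  Cinfty U f -> Cinfty U Y ->
  'D_w (fun x => 'D_(Y x) f x) z = 'D_('D_w Y z) f z + 'D_(Y z) ('D_w f) z.
Proof.
move=> oU Uz cf cY; have nU : nbhs z U by exact: open_nbhs_nbhs.
have dY := Cinfty_differentiable cY Uz.
have dYj j := differentiable_entry j dY.
have dfj j : differentiable ('D_('e_j) f) z.
  exact: Cinfty_differentiable (Cinfty_derive _ cf) Uz.
have -> : 'D_w (fun x => 'D_(Y x) f x) z =
    'D_w (\sum_(j < m) (fun x => Y x 0 j * 'D_('e_j) f x)) z.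
  apply: near_eq_derive; apply: filterS nU => x Ux.
  by rewrite fct_sumE; apply: derive_row_sum; exact: Cinfty_differentiable cf Ux.
rewrite derive_sum => [|j]; last first.
  by apply: derivableM; apply: diff_derivable; [exact: dYj|exact: dfj].
rewrite (derive_row_sum _ (Cinfty_differentiable cf Uz)).
rewrite (derive_row_sum _ (Cinfty_differentiable (Cinfty_derive w cf) Uz)).
rewrite -big_split; apply: eq_bigr => j _ /=.
have E : 'D_w (fun x => Y x 0 j) z = ('D_w Y z) 0 j.
  by rewrite derive_entry //; exact: diff_derivable.
have S : 'D_w ('D_('e_j) f) z = 'D_('e_j) ('D_w f) z.
  exact: (derive_symmetric _ _ oU (cf 2%N) Uz).
rewrite -E -S addrC deriveM; [|exact/diff_derivable/dYj|exact/diff_derivable/dfj].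
by congr (_ + _); exact: mulrC.
Qed.

Lemma derive_along_row p (U : set 'rV[R]_m) (f : 'rV[R]_m -> 'rV[R]_p)
    (Y : 'rV[R]_m -> 'rV[R]_m) (z w : 'rV[R]_m) : open U -> U z ->
  Cinfty U f -> Cinfty U Y ->
  'D_w (fun x => 'D_(Y x) f x) z = 'D_('D_w Y z) f z + 'D_(Y z) ('D_w f) z.
Proof.
move=> oU Uz cf cY; have nU : nbhs z U by exact: open_nbhs_nbhs.
have dE v x j : U x -> ('D_v f x) 0 j = 'D_v (fun y => f y 0 j) x.
  by move=> Ux; apply: derive_entry; exact/diff_derivable/(Cinfty_differentiable cf Ux).
have cA := Cinfty_derive_along oU cf cY.
apply/rowP => j; rewrite mxE.
have E1 : ('D_w (fun x => 'D_(Y x) f x) z) 0 j =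
    'D_w (fun x => 'D_(Y x) (fun y => f y 0 j) x) z.
  have /diff_derivable dz := Cinfty_differentiable cA Uz.
  apply: etrans (derive_entry j (dz w)) _.
  by apply: near_eq_derive; apply: filterS nU => x; exact: dE.
have E3 : ('D_(Y z) ('D_w f) z) 0 j = 'D_(Y z) ('D_w (fun y => f y 0 j)) z.
  have /diff_derivable dz := Cinfty_differentiable (Cinfty_derive w cf) Uz.
  apply: etrans (derive_entry j (dz (Y z))) _.
  by apply: near_eq_derive; apply: filterS nU => x; exact: dE.
apply: etrans E1 (etrans _ (esym (f_equal2 +%R (dE ('D_w Y z) z j Uz) E3))).
by apply: (derive_along_real w oU Uz _ cY); exact/((Cinfty_rowP f oU).1 cf).
Qed.

End DeriveAlong.

(** * Atlases and tangent atlases *)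

(* The part of [smooth_atlas] that does not involve the topology of [N]. *)
Record smooth_transitions (R : realType) (N : Type) (m : nat) (A : atlas R N m) :
    Prop := {
  st_dom : forall p, dom (chart_at A p) p;
  st_open : forall c d : chart A, open (coord c @` (dom c `&` dom d));
  st_coordK : forall (c : chart A) p, dom c p -> point c (coord c p) = p;
  st_smooth : forall c d : chart A,
    Cinfty (coord c @` (dom c `&` dom d)) (coord d \o point c) }.

Section Transitions.
Context {R : realType} {N : Type} {m : nat} (A : atlas R N m).
Hypothesis HA : smooth_transitions A.
Implicit Types (c d e : chart A) (p q : N).

(** Jacobian of the change of charts from c to d at p. Unlike in [tcoord], the source chart is free,
    which allows the cocycle rule [dtrans_comp]. *)
Definition dtrans c d p (v : 'rV[R]_m) : 'rV[R]_m :=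
  'd (coord d \o point c) (coord c p) v.

Definition overlap c d : set 'rV[R]_m := coord c @` (dom c `&` dom d).

Lemma mem_overlap c d p : dom c p -> dom d p -> overlap c d (coord c p).
Proof. by move=> cp dp; exists p. Qed.

Lemma overlap_point c d z : overlap c d z ->
  [/\ dom c (point c z), dom d (point c z) & coord c (point c z) = z].
Proof. by move=> [p [cp dp] <-]; rewrite !(st_coordK HA). Qed.

Lemma near_overlap c d p : dom c p -> dom d p ->
  \forall z \near coord c p, overlap c d z.
Proof.
move=> cp dp; apply: open_nbhs_nbhs; split; first exact: (st_open HA).
exact: mem_overlap.
Qed.

Lemma differentiable_transition c d p : dom c p -> dom d p ->
  differentiable (coord d \o point c) (coord c p).
Proof.
move=> cp dp; apply: (Cinfty_differentiable (st_smooth HA c d)).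
exact: mem_overlap.
Qed.

Lemma dtransE c d p v : dom c p -> dom d p ->
  dtrans c d p v = 'D_v (coord d \o point c) (coord c p).
Proof. by move=> cp dp; rewrite deriveE //; exact: differentiable_transition. Qed.

Lemma dtrans_comp c d e p v : dom c p -> dom d p -> dom e p ->
  dtrans d e p (dtrans c d p v) = dtrans c e p v.
Proof.
move=> cp dp ep; rewrite (dtransE v cp dp) (dtransE v cp ep) (dtransE _ dp ep).
have dcd := differentiable_transition cp dp.
have E : (coord d \o point c) (coord c p) = coord d p.
  by rewrite /= (st_coordK HA).
have dde : differentiable (coord e \o point d) ((coord d \o point c) (coord c p)).
  by rewrite E; exact: differentiable_transition.
rewrite -[in LHS]E -(derive_comp v dcd dde); apply: near_eq_derive.
apply: filterS (near_overlap cp dp) => z /overlap_point[_ dz _] /=.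
by rewrite (st_coordK HA).
Qed.

Lemma dtrans_id c p v : dom c p -> dtrans c c p v = v.
Proof.
move=> cp; rewrite dtransE // -[RHS](derive_id (coord c p)).
apply: near_eq_derive; apply: filterS (near_overlap cp cp) => z.
by move=> /overlap_point[].
Qed.

Lemma tcoord_dtrans c p v : tcoord c p v = dtrans (chart_at A p) c p v.
Proof. by []. Qed.

Lemma tcoord_self p v : tcoord (chart_at A p) p v = v.
Proof. by rewrite tcoord_dtrans dtrans_id //; exact: (st_dom HA). Qed.

Lemma tcoord_change c d p v : dom c p -> dom d p ->
  tcoord d p v = dtrans c d p (tcoord c p v).
Proof.
by move=> cp dp; rewrite !tcoord_dtrans dtrans_comp //; exact: (st_dom HA).
Qed.

Lemma tcoordK c p v : dom c p -> dtrans c (chart_at A p) p (tcoord c p v) = v.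
Proof.
move=> cp; have h := st_dom HA p.
by rewrite tcoord_dtrans dtrans_comp // dtrans_id.
Qed.

Lemma dtransK c p v : dom c p -> tcoord c p (dtrans c (chart_at A p) p v) = v.
Proof.
move=> cp; have h := st_dom HA p.
by rewrite tcoord_dtrans dtrans_comp // dtrans_id.
Qed.

Lemma tcoordD c p v w : tcoord c p (v + w) = tcoord c p v + tcoord c p w.
Proof. exact: linearD. Qed.

Lemma tcoordB c p v w : tcoord c p (v - w) = tcoord c p v - tcoord c p w.
Proof. exact: linearB. Qed.

Lemma field_in_chart_coord c p X : dom c p ->
  field_in_chart c X (coord c p) = tcoord c p (X p).
Proof. by move=> cp; rewrite /field_in_chart (st_coordK HA). Qed.

(** In the chart of p the field is the derivative of the transition psi along the c-components of Y,
    composed with the inverse transition. Differentiating this produces the tensorial term plus the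
    Hessian of psi on (X, Y), the obstruction to differentiating components invariantly. *)
Lemma field_in_chart_derive c p (X Y : N -> 'rV[R]_m) (U : set 'rV[R]_m) :
  dom c p -> open U -> U (coord c p) -> Cinfty U (field_in_chart c Y) ->
  'D_(X p) (field_in_chart (chart_at A p) Y) (coord (chart_at A p) p) =
  dtrans c (chart_at A p) p
    ('D_(tcoord c p (X p)) (field_in_chart c Y) (coord c p)) +
  'D_(tcoord c p (Y p))
    ('D_(tcoord c p (X p)) (coord (chart_at A p) \o point c)) (coord c p).
Proof.
move=> cp oU Up cY; set d := chart_at A p.
have dp : dom d p by exact: (st_dom HA).
pose V := U `&` overlap c d.
have oV : open V by apply: openI => //; exact: (st_open HA).
have Vp : V (coord c p) by split => //; exact: mem_overlap.
have nV : nbhs (coord c p) V by exact: open_nbhs_nbhs.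
have cYV : Cinfty V (field_in_chart c Y) by apply: Cinfty_sub cY => z [].
have cpsi : Cinfty V (coord d \o point c).
  by apply: Cinfty_sub (st_smooth HA c d) => z [].
pose G z := 'D_(field_in_chart c Y z) (coord d \o point c) z.
have cG : Cinfty V G by exact: Cinfty_derive_along.
have dchi := differentiable_transition dp cp.
have E : (coord c \o point d) (coord d p) = coord c p by rewrite /= (st_coordK HA).
have -> : 'D_(X p) (field_in_chart d Y) (coord d p) =
    'D_(X p) (G \o (coord c \o point d)) (coord d p).
  apply: near_eq_derive; apply: filterS (near_overlap dp cp) => z.
  move=> /overlap_point[dz cz Ez]; rewrite /G /= field_in_chart_coord //.
  by rewrite -dtransE // -tcoord_change.
have dG : differentiable G ((coord c \o point d) (coord d p)).
  by rewrite E; exact: Cinfty_differentiable cG Vp.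
rewrite (derive_comp (X p) dchi dG) E -dtransE // -tcoord_dtrans.
apply: etrans (derive_along_row _ oV Vp cpsi cYV) _.
have FE := congr1 (fun b => 'D_b ('D_(tcoord c p (X p)) (coord d \o point c)) (coord c p))
  (field_in_chart_coord Y cp).
exact: (f_equal2 +%R (esym (dtransE _ cp dp)) FE).
Qed.

(** The Hessian terms of [field_in_chart_derive] for (X, Y) and (Y, X) coincide and cancel. This is
    needed because [lie_bracket] uses a different chart at each point, while smoothness is tested in
    a single one. *)
Lemma lie_bracket_in_chart c p (X Y : N -> 'rV[R]_m) (U : set 'rV[R]_m) :
  dom c p -> open U -> U (coord c p) ->
  Cinfty U (field_in_chart c X) -> Cinfty U (field_in_chart c Y) ->
  tcoord c p (lie_bracket A X Y p) =
  'D_(tcoord c p (X p)) (field_in_chart c Y) (coord c p)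
  - 'D_(tcoord c p (Y p)) (field_in_chart c X) (coord c p).
Proof.
move=> cp oU Up cX cY; have dp := st_dom HA p.
have S := derive_symmetric_row (tcoord c p (X p)) (tcoord c p (Y p))
  (@st_open _ _ _ _ HA c (chart_at A p)) (st_smooth HA c (chart_at A p)) (mem_overlap cp dp).
have E1 := etrans (field_in_chart_derive X cp oU Up cY) (congr1 (fun b => _ + b) S).
have E2 := field_in_chart_derive Y cp oU Up cX.
apply: etrans (congr1 (tcoord c p) (f_equal2 (fun a b => a - b) E1 E2)) _.
apply: etrans (congr1 (tcoord c p) (addrKB _ _ _)) _.
apply: etrans (tcoordB _ _ _ _) _.
exact: (f_equal2 (fun a b => a - b) (dtransK _ cp) (dtransK _ cp)).
Qed.

Lemma smooth_lie_bracket (X Y : N -> 'rV[R]_m) p :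
  smooth_field_at A X p -> smooth_field_at A Y p ->
  smooth_field_at A (lie_bracket A X Y) p.
Proof.
move=> [U [oU Up] cX] [V [oV Vp] cY]; set c := chart_at A p.
have dp : dom c p by exact: (st_dom HA).
pose W := U `&` V `&` overlap c c.
have oW : open W by apply: openI; [exact: openI|exact: (st_open HA)].
have cX' : Cinfty W (field_in_chart c X).
  by apply: Cinfty_sub cX => z [[]].
have cY' : Cinfty W (field_in_chart c Y).
  by apply: Cinfty_sub cY => z [[]].
exists W; first by split => //; split => //; exact: mem_overlap.
apply: (@Cinfty_ext _ _ _ _ (fun z =>
  'D_(field_in_chart c X z) (field_in_chart c Y) z
  - 'D_(field_in_chart c Y z) (field_in_chart c X) z)) => //.
  move=> z [[Uz Vz] /overlap_point[cz _ Ez]].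
  have Wz : W (coord c (point c z)) by rewrite Ez; split => //; rewrite -Ez; exact: mem_overlap.
  by have := lie_bracket_in_chart cz oW Wz cX' cY'; rewrite Ez => E; exact: (esym E).
by apply: CinftyB => //; exact: Cinfty_derive_along.
Qed.

End Transitions.

(** * The two blocks of the coordinates (x, y) *)

Section RowBlocks.
Context {R : realType} {n1 n2 : nat}.

Lemma derive_lsubmx (x v : 'rV[R]_(n1 + n2)) : 'D_v lsubmx x = lsubmx v.
Proof.
apply/rowP => j; rewrite derive_entry; last exact/diff_derivable/differentiable_lsubmx.
rewrite mxE; under eq_fun do rewrite mxE.
rewrite -(derive_entry (f := id)); last exact: derivable_id.
by rewrite derive_id.
Qed.

Lemma derive_rsubmx (x v : 'rV[R]_(n1 + n2)) : 'D_v rsubmx x = rsubmx v.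
Proof.
apply/rowP => j; rewrite derive_entry; last exact/diff_derivable/differentiable_rsubmx.
rewrite mxE; under eq_fun do rewrite mxE.
rewrite -(derive_entry (f := id)); last exact: derivable_id.
by rewrite derive_id.
Qed.

Lemma lsubmx_derive (V : normedModType R) (f : V -> 'rV[R]_(n1 + n2)) x v :
  differentiable f x -> lsubmx ('D_v f x) = 'D_v (lsubmx \o f) x.
Proof.
by move=> df; rewrite (derive_comp v df (differentiable_lsubmx _)) derive_lsubmx.
Qed.

Lemma rsubmx_derive (V : normedModType R) (f : V -> 'rV[R]_(n1 + n2)) x v :
  differentiable f x -> rsubmx ('D_v f x) = 'D_v (rsubmx \o f) x.
Proof.
by move=> df; rewrite (derive_comp v df (differentiable_rsubmx _)) derive_rsubmx.
Qed.

Lemma derive_vertical (W : normedModType R) (F : 'rV[R]_(n1 + n2) -> W) x y b :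
  'D_(row_mx 0 b) F (row_mx x y) = 'D_b (fun y' => F (row_mx x y')) y.
Proof.
rewrite /derive.
rewrite (_ : (fun h : R => h^-1 *: ((F \o shift (row_mx x y)) (h *: row_mx 0 b) - _)) =
  fun h => h^-1 *: (((fun y' => F (row_mx x y')) \o shift y) (h *: b) - F (row_mx x y))) //.
by apply/funext => h /=; rewrite scale_row_mx scaler0 add_row_mx add0r.
Qed.

Lemma differentiable_row_mxr (x : 'rV[R]_n1) (y : 'rV[R]_n2) :
  differentiable (fun y' : 'rV[R]_n2 => row_mx x y') y.
Proof.
apply: differentiable_rowP => j; under eq_fun do rewrite mxE.
by case: (fintype.split j) => i; [exact: differentiable_cst|exact: differentiable_coord].
Qed.

Lemma derive_row_mxr (x : 'rV[R]_n1) (y v : 'rV[R]_n2) :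
  'D_v (fun y' : 'rV[R]_n2 => row_mx x y') y = row_mx 0 v.
Proof.
by have := derive_vertical id x y v; rewrite derive_id.
Qed.

Lemma Cinfty_fibre (W : normedModType R) (U : set 'rV[R]_(n1 + n2))
    (f : 'rV[R]_(n1 + n2) -> W) (x : 'rV[R]_n1) : open U -> Cinfty U f ->
  Cinfty ((fun y => row_mx x y) @^-1` U) (fun y => f (row_mx x y)).
Proof.
move=> oU; apply: (Cinfty_affine oU (differentiable_row_mxr x)) => y v.
exact: derive_row_mxr.
Qed.

Lemma Cinfty_lsubmx_comp (W : normedModType R) (U : set 'rV[R]_n1)
    (f : 'rV[R]_n1 -> W) : open U -> Cinfty U f ->
  Cinfty (lsubmx @^-1` U) (fun z : 'rV[R]_(n1 + n2) => f (lsubmx z)).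
Proof.
move=> oU; apply: (Cinfty_affine oU); last exact: derive_lsubmx.
exact: differentiable_lsubmx.
Qed.

End RowBlocks.

Lemma derive_diff {R : realType} {V W : normedModType R} (g : V -> W) p y b :
  differentiable g p -> differentiable ('d g p) y /\ 'D_b ('d g p) y = 'd g p b.
Proof.
move=> dg; have cg := diff_continuous dg.
have d : differentiable ('d g p) y by exact: linear_differentiable.
by split => //; rewrite deriveE // diff_lin.
Qed.

Lemma smooth_atlas_transitions (R : realType) (M : topologicalType) n
    (A : atlas R M n) : smooth_atlas A -> smooth_transitions A.
Proof.
move=> sA; split.
- exact: dom_chart_at sA.
- move=> c d; rewrite openE => z [p [cp dp] <-].
  have cz : (coord c @` dom c) (coord c p) by exists p.
  have n1 : nbhs (coord c p) (coord c @` dom c).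
    by apply: open_nbhs_nbhs; split => //; exact: open_image.
  have n2 : nbhs (coord c p) (point c @^-1` dom d).
    apply: (point_continuous sA cz); rewrite (coordK sA) //.
    by apply: open_nbhs_nbhs; split => //; exact: open_dom.
  apply: filterS2 n1 n2 => w [q cq <-]; rewrite /= (coordK sA) // => dq.
  by exists q.
- exact: coordK sA.
- exact: transition_smooth sA.
Qed.

Section TangentAtlas.
Context {R : realType} {M : Type} {n : nat} (A : atlas R M n).
Hypothesis HA : smooth_transitions A.
Local Notation TM := (tangent_bundle A).
Local Notation TA := (tatlas A).
Implicit Types (c d : chart A) (u w : TM) (z : 'rV[R]_(n + n)).

Lemma tcoord_tpointK c z : overlap c c (lsubmx z) ->
  coord (a := TA) c (point (a := TA) c z) = z.
Proof.
move=> /(overlap_point HA)[cx _ E] /=; rewrite E.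
have := dtransK HA (rsubmx z) cx; rewrite /dtrans E => ->.
exact: hsubmxK.
Qed.

(** Jacobians of transitions are invertible, so the fibre coordinate ranges over all of R^n and only
    the x block is constrained. *)
Lemma overlap_tatlas c d : overlap (A := TA) c d = lsubmx @^-1` overlap c d.
Proof.
apply/seteqP; split => z.
  by move=> [u [cu du] <-] /=; rewrite row_mxKl; exact: mem_overlap.
move=> /= oz; have [cz dz E] := overlap_point HA oz.
exists (point (a := TA) c z); first by split.
by apply: tcoord_tpointK; rewrite -E; exact: mem_overlap.
Qed.

Lemma tatlas_transitions : smooth_transitions TA.
Proof.
have oo c d : open (lsubmx @^-1` overlap c d : set 'rV[R]_(n + n)).
  apply: open_comp; last exact: (st_open HA).
  by move=> z _; exact: continuous_lsubmx.
have key c d : Cinfty (lsubmx @^-1` overlap c d) (coord (a := TA) d \o point (a := TA) c).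
  (* The transition of induced charts is (x, y) |-> (psi x, d psi_x y). Its second block, linear in
     y, is expanded as the sum of y^j 'D_(e_j) psi, which reduces smoothness to that of the partial
     derivatives of psi. *)
  apply: (@Cinfty_ext _ _ _ _ (fun z => row_mx ((coord d \o point c) (lsubmx z))
    (\sum_j (rsubmx z) 0 j *: 'D_('e_j) (coord d \o point c) (lsubmx z)))) => //.
    move=> z /(overlap_point HA)[cx dx E]; rewrite /=; congr row_mx.
    rewrite -derive_row_sum; last by rewrite -E; exact: (differentiable_transition HA).
    rewrite -[in LHS]E -(dtransE HA) // -(dtrans_comp HA _ cx (st_dom HA _) dx).
    by rewrite /dtrans E.
  apply: Cinfty_row_mx => //.
    apply: (Cinfty_lsubmx_comp (f := coord d \o point c)); first exact: (st_open HA).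
    exact: (st_smooth HA).
  apply: Cinfty_sum => // j; apply: CinftyZ => //.
    under eq_fun do rewrite mxE; exact: Cinfty_coord.
  apply: (Cinfty_lsubmx_comp (f := 'D_('e_j) (coord d \o point c))).
    exact: (st_open HA).
  exact/Cinfty_derive/(st_smooth HA).
split.
- by move=> u; exact: (st_dom HA).
- by move=> c d; have := oo c d; rewrite -overlap_tatlas.
- move=> c [x v] /= cx; rewrite row_mxKl row_mxKr (st_coordK HA) //.
  by congr TVec; exact: (tcoordK HA).
- by move=> c d; rewrite -/(overlap (A := TA) c d) overlap_tatlas; exact: key.
Qed.

Let HT := tatlas_transitions.

(** In induced charts the projection [base] is the linear map (x, y) |-> x, hence its own
    differential. *)
Lemma rho_atE u xi : rho_at u xi = lsubmx xi.
Proof.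
rewrite /rho_at /tangent_map /dir_deriv -[RHS](derive_lsubmx (coord (a := TA) (chart_at TA u) u)).
apply: near_eq_derive.
have cu := st_dom HT u.
apply: filterS (near_overlap HT cu cu) => z.
by rewrite overlap_tatlas => /(overlap_point HA)[].
Qed.

Lemma gamma_atE u v : gamma_at u v = row_mx 0 v.
Proof.
rewrite /gamma_at derive1E.
rewrite (_ : (fun t : R => _) =
    fun t => row_mx (coord (chart_at A (base u)) (base u)) (vec u) + t *: row_mx 0 v).
  have d : differentiable id (row_mx (coord (chart_at A (base u)) (base u)) (vec u) +
      (0 : R) *: row_mx 0 v) by exact: ex_diff.
  by have [_ ->] := is_derive_line d; rewrite derive_id.
apply/funext => t /=; rewrite (tcoord_self HA).
by rewrite scale_row_mx scaler0 add_row_mx addr0.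
Qed.

Lemma lsubmx_tcoord c u xi : dom c (base u) ->
  lsubmx (tcoord (A := TA) c u xi) = tcoord c (base u) (lsubmx xi).
Proof.
move=> cu; have du := st_dom HT u.
rewrite [in LHS]tcoord_dtrans (dtransE HT) // lsubmx_derive; last first.
  exact: (differentiable_transition HT).
set d := chart_at A (base u).
have E : coord d (base u) = lsubmx (coord (a := TA) (chart_at TA u) u).
  by rewrite /= row_mxKl.
have dd : differentiable (coord c \o point d) (coord d (base u)).
  by apply: (differentiable_transition HA) => //; exact: (st_dom HA).
rewrite (_ : tcoord _ _ _ = 'D_(lsubmx xi) (coord c \o point d) (coord d (base u))); last first.
  by rewrite deriveE.
rewrite E in dd *; rewrite -[in RHS](derive_lsubmx (coord (a := TA) (chart_at TA u) u) xi).
have dl := differentiable_lsubmx (coord (a := TA) (chart_at TA u) u).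
apply: etrans _ (derive_comp xi dl dd).
rewrite (_ : lsubmx \o _ = (coord c \o point d) \o lsubmx) //.
by apply/funext => z; exact: row_mxKl.
Qed.

(** On a fixed fibre the induced transition is the linear map d psi_x, so its derivative in a
    vertical direction is that same map. *)
Lemma tcoord_vertical c u b : dom c (base u) ->
  tcoord (A := TA) c u (row_mx 0 b) = row_mx 0 (tcoord c (base u) b).
Proof.
move=> cu; have du := st_dom HT u; have dx := st_dom HA (base u).
rewrite -[LHS]hsubmxK lsubmx_tcoord // row_mxKl; congr row_mx.
  exact: linear0.
rewrite [in LHS]tcoord_dtrans (dtransE HT) // rsubmx_derive; last first.
  exact: (differentiable_transition HT).
rewrite /= derive_vertical.
have dd := differentiable_transition HA dx cu.
rewrite (_ : (fun y' => _) =
    'd (coord c \o point (chart_at A (base u))) (coord (chart_at A (base u)) (base u)) :> (_ -> _)).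
  exact: (derive_diff _ b dd).2.
apply/funext => y /=.
rewrite row_mxKr row_mxKl row_mxKr (st_coordK HA) //.
exact: (dtrans_comp HA).
Qed.

End TangentAtlas.

(** * Vertical calculus on the slit tangent bundle *)

Section SmoothNear.
Context {R : realType} {V W : normedModType R}.

Definition smooth_near (f : V -> W) (z : V) : Prop :=
  exists2 U, open_nbhs z U & Cinfty U f.

Lemma smooth_near_ext (f g : V -> W) z : (\near z, f z = g z) ->
  smooth_near f z -> smooth_near g z.
Proof.
move=> fg [U [oU Uz] cf].
pose I := (U `&` [set x | f x = g x])°.
have nI : nbhs z (U `&` [set x | f x = g x]).
  by apply: filterI => //; exact: open_nbhs_nbhs.
exists I; first by split; [exact: open_interior|].
apply: (@Cinfty_ext _ _ _ _ f); first exact: open_interior.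
  by move=> x /interior_subset[].
by apply: Cinfty_sub cf => x /interior_subset[].
Qed.

Lemma smooth_near_differentiable (f : V -> W) z : smooth_near f z -> differentiable f z.
Proof. by move=> [U [oU Uz] cf]; exact: Cinfty_differentiable cf Uz. Qed.

End SmoothNear.

Lemma smooth_near_lift {R : realType} {V W W' : normedModType R}
    (f : V -> W) (h : V -> W') z :
  (forall U, open U -> Cinfty U f -> Cinfty U h) ->
  smooth_near f z -> smooth_near h z.
Proof. by move=> H [U [oU Uz] cf]; exists U => //; exact: H. Qed.

Lemma smooth_near_lift2 {R : realType} {V W W' W'' : normedModType R}
    (f : V -> W) (g : V -> W') (h : V -> W'') z :
  (forall U, open U -> Cinfty U f -> Cinfty U g -> Cinfty U h) ->
  smooth_near f z -> smooth_near g z -> smooth_near h z.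
Proof.
move=> H [U [oU Uz] cf] [U' [oU' Uz'] cg]; have oUU := openI oU oU'.
exists (U `&` U') => //.
by apply: H => //; [apply: Cinfty_sub cf => x []|apply: Cinfty_sub cg => x []].
Qed.

Section SlitCalculus.
Context {R : realType} {M : Type} {n : nat} (A : atlas R M n).
Hypothesis HA : smooth_transitions A.
Local Notation TM := (tangent_bundle A).
Local Notation TA := (tatlas A).
Let HT := tatlas_transitions HA.
Implicit Types (c d : chart A) (u w : TM) (z : 'rV[R]_(n + n)).
Implicit Types (X : vfield A) (Y V : pifield A).

(** The raw values of Y refer to [chart_at], whose jumps would destroy smoothness; differentiation
    across fibres is applied to these components in a fixed chart instead. *)
Definition ploc c Y z : 'rV[R]_n :=
  tcoord c (base (point (a := TA) c z)) (Y (point (a := TA) c z)).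

Definition chart_slit c : set 'rV[R]_(n + n) :=
  [set z | overlap c c (lsubmx z) /\ rsubmx z != 0].

Lemma open_chart_slit c : open (chart_slit c).
Proof.
have -> : chart_slit c = overlap (A := TA) c c `&` rsubmx @^-1` (~` [set 0]).
  rewrite overlap_tatlas //; apply/seteqP; split => z [oz rz]; split => //; exact/eqP.
apply: openI; first exact: (st_open HT).
apply: open_comp => [z _|]; first exact: continuous_rsubmx.
by apply: closed_openC; exact/accessible_closed_set1/hausdorff_accessible/norm_hausdorff.
Qed.

Lemma chart_slit_point c z : chart_slit c z ->
  [/\ dom c (base (point (a := TA) c z)), slit (point (a := TA) c z)
    & coord (a := TA) c (point (a := TA) c z) = z].
Proof.
move=> [oz rz]; have [cz _ E] := overlap_point HA oz.
split => //; last exact: tcoord_tpointK.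
apply: contra rz => /eqP r0.
have := dtransK HA (rsubmx z) cz; rewrite /dtrans E.
by move: r0; rewrite /= => ->; rewrite [X in X = _]linear0 => <-.
Qed.

Lemma mem_chart_slit c u : dom c (base u) -> slit u -> chart_slit c (coord (a := TA) c u).
Proof.
move=> cu su; split; rewrite /= ?row_mxKl ?row_mxKr; first exact: mem_overlap.
apply: contra su => /eqP r0.
by rewrite -(tcoordK HA (vec u) cu) r0 [X in X == _]linear0.
Qed.

Lemma near_chart_slit c u : dom c (base u) -> slit u ->
  \forall z \near coord (a := TA) c u, chart_slit c z.
Proof.
move=> cu su; apply: open_nbhs_nbhs; split; first exact: open_chart_slit.
exact: mem_chart_slit.
Qed.

Lemma dom_base u : dom (chart_at A (base u)) (base u).
Proof. exact: (st_dom HA). Qed.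

Lemma smooth_pifield_atE Y u : smooth_pifield_at Y u =
  smooth_near (ploc (chart_at A (base u)) Y) (coord (a := TA) (chart_at A (base u)) u).
Proof. by []. Qed.

Lemma smooth_field_atE X u : smooth_field_at TA X u =
  smooth_near (field_in_chart (A := TA) (chart_at A (base u)) X)
    (coord (a := TA) (chart_at A (base u)) u).
Proof. by []. Qed.

Lemma near_ploc_eq c Y Y' u : dom c (base u) -> slit u ->
  (forall w, slit w -> Y w = Y' w) ->
  \forall z \near coord (a := TA) c u, ploc c Y z = ploc c Y' z.
Proof.
move=> cu su E; apply: filterS (near_chart_slit cu su) => z /chart_slit_point[_ sz _].
by rewrite /ploc E.
Qed.

Lemma near_field_eq c X X' u : dom c (base u) -> slit u ->
  (forall w, slit w -> X w = X' w) ->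
  \forall z \near coord (a := TA) c u,
    field_in_chart (A := TA) c X z = field_in_chart (A := TA) c X' z.
Proof.
move=> cu su E; apply: filterS (near_chart_slit cu su) => z /chart_slit_point[_ sz _].
by rewrite /field_in_chart E.
Qed.

Lemma smooth_pifield_at_ext Y Y' u : slit u -> (forall w, slit w -> Y w = Y' w) ->
  smooth_pifield_at Y u -> smooth_pifield_at Y' u.
Proof.
move=> su E; rewrite !smooth_pifield_atE; apply: smooth_near_ext.
exact: near_ploc_eq (dom_base u) su E.
Qed.

Lemma smooth_pifieldD Y Y' u : smooth_pifield_at Y u -> smooth_pifield_at Y' u ->
  smooth_pifield_at (Y \+ Y') u.
Proof.
rewrite !smooth_pifield_atE; apply: smooth_near_lift2 => U oU cY cY'.
apply: (Cinfty_ext oU _ (CinftyD oU cY cY')) => z _.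
by rewrite /ploc /= tcoordD.
Qed.

Lemma smooth_pifieldB Y Y' u : smooth_pifield_at Y u -> smooth_pifield_at Y' u ->
  smooth_pifield_at (Y \- Y') u.
Proof.
rewrite !smooth_pifield_atE; apply: smooth_near_lift2 => U oU cY cY'.
apply: (Cinfty_ext oU _ (CinftyB oU cY cY')) => z _.
by rewrite /ploc /= tcoordB.
Qed.

Lemma smooth_pifield0 u : smooth_pifield_at (fun=> 0 : 'rV[R]_n) u.
Proof.
rewrite smooth_pifield_atE; exists setT; first by split; [exact: openT|].
apply: (Cinfty_ext openT _ (Cinfty_cst _ (0 : 'rV[R]_n))) => z _.
by rewrite /ploc [RHS]linear0.
Qed.

Lemma lsub_field_in_chart c X z : chart_slit c z ->
  lsubmx (field_in_chart (A := TA) c X z) = ploc c (rho X) z.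
Proof.
move=> /chart_slit_point[cz _ _].
by rewrite /field_in_chart /ploc lsubmx_tcoord // /rho rho_atE.
Qed.

Lemma gamma_in_chart c V z : chart_slit c z ->
  field_in_chart (A := TA) c (gamma V) z = row_mx 0 (ploc c V z).
Proof.
move=> /chart_slit_point[cz _ _].
by rewrite /field_in_chart /ploc /gamma gamma_atE // tcoord_vertical.
Qed.

Lemma smooth_rho X u : slit u -> smooth_field_at TA X u -> smooth_pifield_at (rho X) u.
Proof.
move=> su; rewrite smooth_field_atE smooth_pifield_atE => sX.
set c := chart_at A (base u) in sX *.
apply: (@smooth_near_ext _ _ _ (fun z => lsubmx (field_in_chart (A := TA) c X z))).
  apply: filterS (near_chart_slit (dom_base u) su) => z; exact: lsub_field_in_chart.
by apply: smooth_near_lift sX => U oU; exact: Cinfty_lsubmx.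
Qed.

Lemma smooth_gamma V u : slit u -> smooth_pifield_at V u -> smooth_field_at TA (gamma V) u.
Proof.
move=> su; rewrite smooth_field_atE smooth_pifield_atE => sV.
set c := chart_at A (base u) in sV *.
apply: (@smooth_near_ext _ _ _ (fun z => row_mx 0 (ploc c V z))).
  by apply: filterS (near_chart_slit (dom_base u) su) => z cz; rewrite gamma_in_chart.
apply: smooth_near_lift sV => U oU.
by apply: Cinfty_row_mx => //; exact: Cinfty_cst.
Qed.

Lemma smooth_eta u : slit u -> smooth_pifield_at (@eta R M n A) u.
Proof.
move=> su; rewrite smooth_pifield_atE.
set c := chart_at A (base u).
apply: (@smooth_near_ext _ _ _ rsubmx).
  apply: filterS (near_chart_slit (dom_base u) su) => z /chart_slit_point[_ _ {1}<-].
  by rewrite /ploc /= row_mxKr.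
exists setT; first by split; [exact: openT|].
have oT := @openT 'rV[R]_(n + n).
by apply: (Cinfty_rsubmx (f := id) oT); apply/(Cinfty_rowP _ oT) => j; exact: Cinfty_coord.
Qed.

(** Along a fibre the base point, hence the chart defining the components, is fixed; this is why the
    raw values of Y may be differentiated here. *)
Definition vd Y u v : 'rV[R]_n := 'D_v (fun y => Y (TVec (base u) y)) (vec u).

Lemma fibre_coord u : coord (a := TA) (chart_at A (base u)) u =
  row_mx (coord (chart_at A (base u)) (base u)) (vec u).
Proof. by rewrite /= tcoord_self. Qed.

Lemma point_fibre x y :
  point (a := TA) (chart_at A x) (row_mx (coord (chart_at A x) x) y) = TVec x y.
Proof.
by have := fibre_coord (TVec x y) => /= <-; exact: (st_coordK HT (dom_base (TVec x y))).
Qed.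

Lemma fibre_ploc Y u y : Y (TVec (base u) y) =
  ploc (chart_at A (base u)) Y
    (row_mx (coord (chart_at A (base u)) (base u)) y).
Proof.
by rewrite /ploc point_fibre tcoord_self.
Qed.

Lemma smooth_fibre Y u : smooth_pifield_at Y u ->
  smooth_near (fun y => Y (TVec (base u) y)) (vec u).
Proof.
rewrite smooth_pifield_atE fibre_coord => -[U [oU Uu] cY].
exists ((fun y => row_mx (coord (chart_at A (base u)) (base u)) y) @^-1` U).
  split => //; apply: open_comp => // y _.
  exact/differentiable_continuous/differentiable_row_mxr.
rewrite (_ : (fun y => Y _) = fun y => ploc (chart_at A (base u)) Y
    (row_mx (coord (chart_at A (base u)) (base u)) y)); first exact: Cinfty_fibre.
by apply/funext => y; exact: fibre_ploc.
Qed.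

Lemma vd_dirD Y u v v' :
  smooth_pifield_at Y u -> vd Y u (v + v') = vd Y u v + vd Y u v'.
Proof. by move=> /smooth_fibre/smooth_near_differentiable; exact: derive_dirD. Qed.

Lemma vd_dirB Y u v v' :
  smooth_pifield_at Y u -> vd Y u (v - v') = vd Y u v - vd Y u v'.
Proof. by move=> /smooth_fibre/smooth_near_differentiable; exact: derive_dirB. Qed.

Lemma vdD Y Y' u v : smooth_pifield_at Y u -> smooth_pifield_at Y' u ->
  vd (Y \+ Y') u v = vd Y u v + vd Y' u v.
Proof.
move=> /smooth_fibre/smooth_near_differentiable d.
move=> /smooth_fibre/smooth_near_differentiable d'.
by apply: deriveD; exact: diff_derivable.
Qed.

Lemma vd_eta u v : vd (@eta R M n A) u v = v.
Proof. exact: derive_id. Qed.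

Lemma vd0 u v : vd (fun=> 0 : 'rV[R]_n) u v = 0.
Proof. exact: derive_cst. Qed.

Lemma near_slit u : slit u -> \forall y \near vec u, slit (TVec (base u) y : TM).
Proof.
move=> su; apply: open_nbhs_nbhs; split; last exact: su.
rewrite (_ : (fun y => _) = ~` [set 0]).
  by apply: closed_openC; exact/accessible_closed_set1/hausdorff_accessible/norm_hausdorff.
by apply/seteqP; split => y /eqP.
Qed.

Lemma vd_ext Y Y' u v : slit u -> (forall w, slit w -> Y w = Y' w) ->
  vd Y u v = vd Y' u v.
Proof.
by move=> su E; apply: near_eq_derive; apply: filterS (near_slit su) => y; exact: E.
Qed.

(** Restricted to one fibre, a change of chart is a constant linear map both on arguments and on
    values. It therefore commutes with differentiation, and [vd] has the same form in every
    chart. *)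
Lemma vd_in_chart c Y w v : dom c (base w) ->
  differentiable (ploc c Y) (coord (a := TA) c w) ->
  tcoord c (base w) (vd Y w v) =
  'D_(row_mx 0 (tcoord c (base w) v)) (ploc c Y) (coord (a := TA) c w).
Proof.
move=> cw dY; set x := base w.
pose h y := ploc c Y (row_mx (coord c x) y).
have dx := dom_base w.
pose g := coord c \o point (chart_at A x).
pose gi := coord (chart_at A x) \o point c.
have dg : differentiable g (coord (chart_at A x) x) := differentiable_transition HA dx cw.
have dgi : differentiable gi (coord c x) := differentiable_transition HA cw dx.
have dh : differentiable h (tcoord c x (vec w)).
  exact: (differentiable_comp (differentiable_row_mxr _ _) dY).
have Yh : (fun y => Y (TVec x y)) = 'd gi (coord c x) \o (h \o 'd g (coord (chart_at A x) x)).
  apply/funext => y; rewrite /h /ploc /= row_mxKl row_mxKr (st_coordK HA) //.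
  have K v' : 'd gi (coord c x) ('d g (coord (chart_at A x) x) v') = v' by exact: (tcoordK HA).
  by rewrite [RHS](tcoordK HA) // K.
have [dL DL] := derive_diff (vec w) v dg.
have dhL : differentiable (h \o 'd g (coord (chart_at A x) x)) (vec w).
  exact: differentiable_comp.
have [dL' DL'] := derive_diff ((h \o 'd g (coord (chart_at A x) x)) (vec w))
  ('D_v (h \o 'd g (coord (chart_at A x) x)) (vec w)) dgi.
rewrite /vd Yh.
have E1 := etrans (derive_comp v dhL dL') DL'.
have E2 := etrans (derive_comp v dL dh) (congr1 (fun b => 'D_b h (tcoord c x (vec w))) DL).
apply: etrans (congr1 (tcoord c x) E1) _; apply: etrans (dtransK HA _ cw) _.
exact: etrans E2 (esym (derive_vertical _ _ _ _)).
Qed.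

Lemma smooth_vd Y V u : slit u -> smooth_pifield_at Y u -> smooth_pifield_at V u ->
  smooth_pifield_at (fun w => vd Y w (V w)) u.
Proof.
move=> su; rewrite !smooth_pifield_atE.
set c := chart_at A (base u) => sY sV.
apply: (@smooth_near_ext _ _ _ (fun z => 'D_(row_mx 0 (ploc c V z)) (ploc c Y) z)).
  have [U [oU Uu] cY] := sY.
  have nU : nbhs (coord (a := TA) c u) U by exact: open_nbhs_nbhs.
  apply: filterS2 nU (near_chart_slit (dom_base u) su) => z Uz /chart_slit_point[cz _ E].
  have dz : differentiable (ploc c Y) (coord (a := TA) c (point (a := TA) c z)).
    by rewrite E; exact: Cinfty_differentiable cY Uz.
  by have := vd_in_chart (V (point (a := TA) c z)) cz dz; rewrite E => F; exact: (esym F).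
apply: smooth_near_lift2 sY sV => U oU cY cV.
apply: (Cinfty_derive_along oU cY (X := fun z => row_mx 0 (ploc c V z))).
by apply: Cinfty_row_mx => //; exact: Cinfty_cst.
Qed.

(** The two second-order terms are second derivatives of Z along V and W, equal by symmetry; only
    the terms differentiating V and W survive. *)
Lemma vd_commutator Z V W u : smooth_pifield_at Z u -> smooth_pifield_at V u ->
  smooth_pifield_at W u ->
  vd (fun w => vd Z w (V w)) u (W u) - vd (fun w => vd Z w (W w)) u (V u) =
  vd Z u (vd V u (W u) - vd W u (V u)).
Proof.
case: u => x y0.
move=> /smooth_fibre[U1 [a1 u1] c1] /smooth_fibre[U2 [a2 u2] c2] /smooth_fibre[U3 [a3 u3] c3].
pose U := U1 `&` U2 `&` U3.
have oU : open U by apply: openI => //; exact: openI.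
have Uy : U y0 by [].
have {}c1 : Cinfty U (fun y => Z (TVec x y)) by apply: Cinfty_sub c1 => z [[]].
have {}c2 : Cinfty U (fun y => V (TVec x y)) by apply: Cinfty_sub c2 => z [[]].
have {}c3 : Cinfty U (fun y => W (TVec x y)) by apply: Cinfty_sub c3 => z [].
have E1 := derive_along_row (W (TVec x y0)) oU Uy c1 c2.
have E2 := derive_along_row (V (TVec x y0)) oU Uy c1 c3.
have S := derive_symmetric_row (V (TVec x y0)) (W (TVec x y0)) oU c1 Uy.
have d1 := Cinfty_differentiable c1 Uy.
have E2' := etrans E2 (f_equal (fun b => _ + b) S).
apply: etrans (f_equal2 (fun a b => a - b) E1 E2') (etrans (addrKB _ _ _) _).
exact: (esym (derive_dirB _ _ d1)).
Qed.

Lemma lie_bracket_ext X X' W W' u : slit u -> (forall w, slit w -> X w = X' w) ->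
  (forall w, slit w -> W w = W' w) ->
  lie_bracket TA X W u = lie_bracket TA X' W' u.
Proof.
move=> su E F; rewrite /lie_bracket (E _ su) (F _ su).
have E1 := near_eq_derive (X' u) (near_field_eq (dom_base u) su F).
have E2 := near_eq_derive (W' u) (near_field_eq (dom_base u) su E).
exact: (f_equal2 (fun a b => a - b) E1 E2).
Qed.

Lemma lie_bracketC X W u : lie_bracket TA X W u = - lie_bracket TA W X u.
Proof. by rewrite /lie_bracket opprB. Qed.

Lemma lie_bracketBl X X' W u : smooth_field_at TA X u -> smooth_field_at TA X' u ->
  smooth_field_at TA W u ->
  lie_bracket TA (X \- X') W u = lie_bracket TA X W u - lie_bracket TA X' W u.
Proof.
move=> /smooth_near_differentiable dX /smooth_near_differentiable dX'.
move=> /smooth_near_differentiable dW.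
rewrite /lie_bracket; set c := chart_at TA u.
have -> : field_in_chart c (X \- X') = field_in_chart c X \- field_in_chart c X'.
  by apply/funext => z; rewrite /field_in_chart /= tcoordB.
have E1 : 'D_((X \- X') u) (field_in_chart c W) (coord c u) =
  'D_(X u) (field_in_chart c W) (coord c u) - 'D_(X' u) (field_in_chart c W) (coord c u).
  exact: derive_dirB.
have E2 : 'D_(W u) (field_in_chart c X \- field_in_chart c X') (coord c u) =
  'D_(W u) (field_in_chart c X) (coord c u) - 'D_(W u) (field_in_chart c X') (coord c u).
  by apply: deriveB; exact: diff_derivable.
apply: etrans (f_equal2 (fun a b => a - b) E1 E2) _.
exact: subrBACA.
Qed.

Lemma derive_ploc Y u v : smooth_pifield_at Y u ->
  'D_(row_mx 0 v) (ploc (chart_at A (base u)) Y) (coord (a := TA) (chart_at A (base u)) u) =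
  vd Y u v.
Proof.
move=> /smooth_near_differentiable dY.
have := vd_in_chart v (dom_base u) dY; rewrite !(tcoord_self HA) => E; exact: (esym E).
Qed.

Lemma lsub_derive_field X u v : slit u -> smooth_field_at TA X u ->
  lsubmx ('D_v (field_in_chart (A := TA) (chart_at A (base u)) X)
    (coord (a := TA) (chart_at A (base u)) u)) =
  'D_v (ploc (chart_at A (base u)) (rho X)) (coord (a := TA) (chart_at A (base u)) u).
Proof.
move=> su /smooth_near_differentiable dX; apply: etrans (lsubmx_derive v dX) _.
apply: near_eq_derive; apply: filterS (near_chart_slit (dom_base u) su) => z.
exact: lsub_field_in_chart.
Qed.

Lemma rsub_derive_gamma Y u v : slit u -> smooth_pifield_at Y u ->
  rsubmx ('D_v (field_in_chart (A := TA) (chart_at A (base u)) (gamma Y))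
    (coord (a := TA) (chart_at A (base u)) u)) =
  'D_v (ploc (chart_at A (base u)) Y) (coord (a := TA) (chart_at A (base u)) u).
Proof.
move=> su /(smooth_gamma su)/smooth_near_differentiable dX.
apply: etrans (rsubmx_derive v dX) _.
apply: near_eq_derive; apply: filterS (near_chart_slit (dom_base u) su) => z cz.
exact: etrans (f_equal rsubmx (gamma_in_chart Y cz)) (row_mxKr _ _).
Qed.

Lemma gammaE V w : gamma V w = row_mx 0 (V w).
Proof. exact: gamma_atE. Qed.

Lemma rho_gamma V w : rho (gamma V) w = 0.
Proof. by rewrite /rho /gamma rho_atE // gamma_atE // row_mxKl. Qed.

(** Of the two terms of the bracket, the one differentiating gamma V has zero x block because rho
    (gamma V) = 0 everywhere. *)
Lemma rho_bracket_gamma V X u : slit u -> smooth_pifield_at V u ->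
  smooth_field_at TA X u ->
  lsubmx (lie_bracket TA (gamma V) X u) = vd (rho X) u (V u).
Proof.
move=> su sV sX.
apply: etrans (linearB _ _ _) _.
have E1 := lsub_derive_field (gamma V u) su sX.
have E2 := lsub_derive_field (X u) su (smooth_gamma su sV).
have E3 : 'D_(X u) (ploc (chart_at A (base u)) (rho (gamma V)))
    (coord (a := TA) (chart_at A (base u)) u) = 0.
  rewrite -(derive_cst (0 : 'rV[R]_n) (coord (a := TA) (chart_at A (base u)) u) (X u)).
  by apply: near_eq_derive; near=> z; rewrite /ploc rho_gamma; exact: linear0.
apply: etrans (f_equal2 (fun a b => a - b) E1 (etrans E2 E3)) (etrans (subr0 _) _).
by rewrite gammaE; apply: derive_ploc; exact: smooth_rho.
Unshelve. all: by end_near.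
Qed.

Lemma bracket_gamma_gamma V W u : slit u -> smooth_pifield_at V u ->
  smooth_pifield_at W u ->
  lie_bracket TA (gamma V) (gamma W) u = gamma_at u (vd W u (V u) - vd V u (W u)).
Proof.
move=> su sV sW; have sG := smooth_gamma su sW.
rewrite gamma_atE // -[LHS]hsubmxK; congr row_mx.
  rewrite rho_bracket_gamma // -[RHS](vd0 u (V u)); apply: vd_ext => // w _.
  exact: rho_gamma.
apply: etrans (linearB _ _ _) _.
have E1 := etrans (rsub_derive_gamma (gamma V u) su sW).
have E2 := etrans (rsub_derive_gamma (gamma W u) su sV).
by apply: (f_equal2 (fun a b => a - b)); [apply: E1|apply: E2];
  rewrite gammaE; exact: derive_ploc.
Qed.

End SlitCalculus.

Lemma smooth_near_family {R : realType} {V W : normedModType R} (I : finType)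
    (f : I -> V -> W) z : (forall i, smooth_near (f i) z) ->
  exists2 U, open_nbhs z U & forall i, Cinfty U (f i).
Proof.
move=> sf.
have /choice[U HU] : forall i, exists U, open_nbhs z U /\ Cinfty U (f i).
  by move=> i; have [U oU cU] := sf i; exists U.
exists [set x | forall i, U i x]°.
  split; first exact: open_interior.
  by apply: filter_forall => i; have [? _] := HU i; exact: open_nbhs_nbhs.
move=> i; have [_] := HU i; apply: Cinfty_sub => x.
by move=> /interior_subset; exact.
Qed.

(** * Regular connections *)

Section Connections.
Context {R : realType} {M : Type} {n : nat} (A : atlas R M n).
Hypothesis HA : smooth_transitions A.
Local Notation TM := (tangent_bundle A).
Local Notation TA := (tatlas A).
Let HT := tatlas_transitions HA.
Variable D : connection A.
Hypothesis HD : linear_connection D.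
Implicit Types (c d : chart A) (u w : TM) (z xi zeta : 'rV[R]_(n + n)).
Implicit Types (X : vfield A) (Y V : pifield A).

(* By the Leibniz rule for the indicator function of [slit]. *)
Lemma conn_local u xi Y Y' : slit u -> (forall w, slit w -> Y w = Y' w) ->
  smooth_pifield_at Y u -> D u xi Y = D u xi Y'.
Proof.
move=> su E sY; have sY' := smooth_pifield_at_ext HA su E sY.
pose f w : R := if vec w != 0 then 1 else 0.
have nf : \forall z \near coord (a := TA) (chart_at TA u) u,
    cst 1 z = (f \o point (a := TA) (chart_at TA u)) z.
  apply: filterS (near_chart_slit HA (dom_base HA u) su) => z.
  by move=> /(chart_slit_point HA)[_ sz _]; rewrite /f /= ifT.
have sf : smooth_at TA f u.
  apply: (@smooth_near_ext _ _ _ (cst (1 : R))) => //.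
  by exists setT; [split; [exact: openT|]|exact: Cinfty_cst].
have df : dir_deriv TA f u xi = 0.
  rewrite /dir_deriv.
  rewrite -(derive_cst (1 : R) (coord (a := TA) (chart_at TA u) u) xi).
  by apply/esym/near_eq_derive.
have fu : f u = 1 by rewrite /f ifT.
have fE : (fun w => f w *: Y w) = (fun w => f w *: Y' w).
  apply/funext => w; rewrite /f; case: ifPn => [/E -> //|_].
  by rewrite !scale0r.
have := conn_leibniz HD xi su sf sY; rewrite fE (conn_leibniz HD xi su sf sY').
by rewrite df fu !scale0r !addr0 !scale1r.
Qed.

Lemma conn_sub u xi Y Y' : slit u -> smooth_pifield_at Y u ->
  smooth_pifield_at Y' u -> D u xi (Y \- Y') = D u xi Y - D u xi Y'.
Proof.
move=> su sY sY'; apply/eqP; rewrite eq_sym subr_eq; apply/eqP.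
rewrite -conn_add //; last exact: smooth_pifieldB.
by congr (D u xi _); apply/funext => w /=; rewrite subrK.
Qed.

Lemma conn_dirD u xi zeta Y : slit u -> smooth_pifield_at Y u ->
  D u (xi + zeta) Y = D u xi Y + D u zeta Y.
Proof.
by move=> su sY; have := conn_linear HD 1 xi zeta su sY; rewrite !scale1r.
Qed.

Lemma conn_dir0 u Y : slit u -> smooth_pifield_at Y u -> D u 0 Y = 0.
Proof.
move=> su sY; have := conn_dirD 0 0 su sY; rewrite addr0 => E.
by apply: (@addrI _ (D u 0 Y)); rewrite addr0 -E.
Qed.

Lemma conn_dirZ u k xi Y : slit u -> smooth_pifield_at Y u ->
  D u (k *: xi) Y = k *: D u xi Y.
Proof.
by move=> su sY; have := conn_linear HD k xi 0 su sY; rewrite conn_dir0 // !addr0.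
Qed.

Lemma conn_dirB u xi zeta Y : slit u -> smooth_pifield_at Y u ->
  D u (xi - zeta) Y = D u xi Y - D u zeta Y.
Proof. by move=> su sY; rewrite conn_dirD // -scaleN1r conn_dirZ // scaleN1r. Qed.

Lemma conn_sec0 u xi : slit u -> D u xi (fun=> 0) = 0.
Proof.
move=> su; have s0 := smooth_pifield0 u.
rewrite -[RHS](subrr (D u xi (fun=> 0))) -conn_sub //.
by congr (D u xi _); apply/funext => w /=; rewrite subr0.
Qed.

Lemma Kmap_dirD u xi zeta : slit u ->
  Kmap_at D u (xi + zeta) = Kmap_at D u xi + Kmap_at D u zeta.
Proof. by move=> su; apply: conn_dirD => //; exact: smooth_eta. Qed.

Lemma Kmap_dirB u xi zeta : slit u ->
  Kmap_at D u (xi - zeta) = Kmap_at D u xi - Kmap_at D u zeta.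
Proof. by move=> su; apply: conn_dirB => //; exact: smooth_eta. Qed.

Lemma Kmap_dirZ u k xi : slit u -> Kmap_at D u (k *: xi) = k *: Kmap_at D u xi.
Proof. by move=> su; apply: conn_dirZ => //; exact: smooth_eta. Qed.

Lemma Kmap_dir0 u : slit u -> Kmap_at D u 0 = 0.
Proof. by move=> su; apply: conn_dir0 => //; exact: smooth_eta. Qed.

Lemma smooth_Kmap X u : slit u -> smooth_field_at TA X u -> smooth_pifield_at (Kmap D X) u.
Proof. by move=> su sX; apply: (conn_smooth HD su sX); exact: smooth_eta. Qed.

Lemma rho_atB u xi zeta : rho_at u (xi - zeta) = rho_at u xi - rho_at u zeta.
Proof. by rewrite !rho_atE //; exact: linearB. Qed.

Hypothesis HR : regular D.

Lemma beta_atP u v : slit u ->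
  Kmap_at D u (beta_at D u v) = 0 /\ rho_at u (beta_at D u v) = v.
Proof.
(* Any lift of v will do; [row_mx v 0] is one, and its horizontal part still projects to v. *)
move=> su; have [/(_ (row_mx v 0))[a [h [ra Kh E]]] _] := HR su.
apply: (@xgetPex _ 0 [set xi | Kmap_at D u xi = 0 /\ rho_at u xi = v]).
exists h; split => //; rewrite rho_atE // in ra.
rewrite -[RHS](row_mxKl v (0 : 'rV[R]_n)) E [RHS]linearD [X in X + _]ra add0r.
exact: rho_atE.
Qed.

Lemma beta_at_unique u v xi : slit u -> Kmap_at D u xi = 0 -> rho_at u xi = v ->
  xi = beta_at D u v.
Proof.
move=> su K0 r0; have [Kb rb] := beta_atP v su.
have [_ H] := HR su; apply/eqP; rewrite -subr_eq0; apply/eqP/H.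
  by rewrite rho_atB r0 rb subrr.
by rewrite Kmap_dirB // K0 Kb subrr.
Qed.

Lemma rho_beta Y u : slit u -> rho (beta D Y) u = Y u.
Proof. by move=> su; exact: (beta_atP (Y u) su).2. Qed.

Lemma Kmap_beta Y u : slit u -> Kmap D (beta D Y) u = 0.
Proof. by move=> su; exact: (beta_atP (Y u) su).1. Qed.

Lemma Kgamma_inj u v : slit u -> Kmap_at D u (gamma_at u v) = 0 -> v = 0.
Proof.
move=> su K0; have [_ H] := HR su.
have : gamma_at u v = 0.
  by apply: H => //; rewrite rho_atE // gamma_atE // row_mxKl.
by rewrite gamma_atE // => /eqP; rewrite -(row_mx0 R 1 n n) => /eqP/eq_row_mx[].
Qed.

(** [beta_at] selects the horizontal lift pointwise, so smoothness requires a formula. A smooth lift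
    X0 of Y is corrected by the vertical vector gamma v with K (gamma v) = K X0; in a fixed chart
    this is a linear system with smooth matrix, invertible because the vertical and horizontal
    spaces meet in 0. *)
Lemma smooth_beta Y u : slit u -> smooth_pifield_at Y u ->
  smooth_field_at TA (beta D Y) u.
Proof.
move=> su sY; set c := chart_at A (base u).
have nc := near_chart_slit HA (dom_base HA u) su.
(* Sections with constant components in the chart c of u: a smooth local frame. *)
pose E (i : 'I_n) : pifield A := fun w => dtrans c (chart_at A (base w)) (base w) 'e_i.
have sE i : smooth_pifield_at (E i) u.
  rewrite smooth_pifield_atE -/c; apply: (@smooth_near_ext _ _ _ (cst 'e_i)).
    apply: filterS nc => z /(chart_slit_point HA)[cz _ _].
    by rewrite /ploc /E (dtransK HA).
  by exists setT; [split; [exact: openT|]|exact: Cinfty_cst].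
pose KE i : pifield A := Kmap D (gamma (E i)).
have sKE i : smooth_pifield_at (KE i) u by exact/smooth_Kmap/smooth_gamma.
(* The lift of Y with zero y block in the chart c. *)
pose X0 : vfield A := fun w =>
  dtrans (A := TA) c (chart_at TA w) w (row_mx (tcoord c (base w) (Y w)) 0).
have X0E z : chart_slit c z ->
    field_in_chart (A := TA) c X0 z = row_mx (ploc c Y z) 0.
  by move=> /(chart_slit_point HA)[cz _ _]; rewrite /field_in_chart (dtransK HT).
have sX0 : smooth_field_at TA X0 u.
  rewrite smooth_field_atE -/c.
  apply: (@smooth_near_ext _ _ _ (fun z => row_mx (ploc c Y z) 0)).
    by apply: filterS nc => z /X0E ->.
  rewrite smooth_pifield_atE in sY; apply: smooth_near_lift sY => U oU cY.
  by apply: Cinfty_row_mx => //; exact: Cinfty_cst.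
have sk : smooth_pifield_at (Kmap D X0) u by exact: smooth_Kmap.
(* Row i holds the components of K (gamma E_i), so [Am] represents v |-> K (gamma v) acting on row
   vectors. *)
pose Am z : 'M[R]_n := \matrix_i ploc c (KE i) z.
have AmE z (om : 'rV[R]_n) : chart_slit c z -> let w := point (a := TA) c z in
    tcoord c (base w) (Kmap_at D w (gamma_at w (dtrans c (chart_at A (base w)) (base w) om)))
    = om *m Am z.
  move=> /(chart_slit_point HA)[cz sz _] w.
  rewrite {1}(row_sum_delta om) /dtrans linear_sum.
  rewrite mulmx_sum_row.
  have -> : gamma_at w (\sum_(i < n) 'd (coord (chart_at A (base w)) \o point c)
      (coord c (base w)) (om 0 i *: 'e_i)) = \sum_(i < n) om 0 i *: gamma (E i) w.
    rewrite gamma_atE //; under [in RHS]eq_bigr do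
      rewrite gammaE // scale_row_mx scaler0.
    rewrite -[LHS]hsubmxK -[RHS]hsubmxK; congr row_mx.
      by rewrite row_mxKl linear_sum big1 // => i _; rewrite [LHS]row_mxKl.
    rewrite row_mxKr linear_sum; apply: eq_bigr => i _.
    by rewrite [RHS]row_mxKr [LHS]linearZ.
  have Ksum : Kmap_at D w (\sum_(i < n) om 0 i *: gamma (E i) w) =
      \sum_(i < n) om 0 i *: KE i w.
    elim/big_rec2: _ => [|i a b _ <-]; first exact: Kmap_dir0.
    by rewrite Kmap_dirD // Kmap_dirZ.
  rewrite Ksum [LHS]linear_sum; apply: eq_bigr => i _.
  by rewrite rowK [LHS]linearZ.
have Au z : chart_slit c z -> Am z \in unitmx.
  move=> cz; have [cz' sz _] := chart_slit_point HA cz.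
  rewrite -row_free_unit; apply/inj_row_free => om; rewrite -AmE //= => H.
  have := congr1 (dtrans c (chart_at A (base (point (a := TA) c z)))
    (base (point (a := TA) c z))) H.
  rewrite (tcoordK HA) // [RHS]linear0 => /(Kgamma_inj sz) H0.
  by rewrite -[LHS](dtransK HA om cz') H0 [LHS]linear0.
have E1 z : chart_slit c z -> row_mx (ploc c Y z)
    (- (ploc c (Kmap D X0) z *m invmx (Am z))) =
    field_in_chart (A := TA) c (beta D Y) z.
  move=> cz; have [cz' sz _] := chart_slit_point HA cz.
  set w := point (a := TA) c z in cz' sz *.
  set om := ploc c (Kmap D X0) z *m invmx (Am z).
  set v := dtrans c (chart_at A (base w)) (base w) om.
  have Kv : Kmap_at D w (gamma_at w v) = Kmap D X0 w.
    rewrite -[LHS](tcoordK HA _ cz') AmE // mulmxKV ?Au //.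
    exact: (tcoordK HA).
  (* The corrected lift is horizontal and projects to Y, hence it is the vector chosen by
     [beta_at]. *)
  have bE : X0 w - gamma_at w v = beta_at D w (Y w).
    apply: beta_at_unique => //.
      by rewrite Kmap_dirB // Kv subrr.
    rewrite rho_atB (rho_atE HA _ (gamma_at _ _)) gamma_atE // row_mxKl subr0 rho_atE //.
    rewrite -[LHS](tcoordK HA _ cz') -lsubmx_tcoord //.
    by rewrite [X in lsubmx X](dtransK HT) // row_mxKl (tcoordK HA).
  rewrite /field_in_chart -/w /beta -bE tcoordB gamma_atE // tcoord_vertical //.
  rewrite [X in X - _](X0E _ cz) (dtransK HA) // opp_row_mx add_row_mx.
  by rewrite oppr0 addr0 add0r.
rewrite smooth_field_atE -/c.
apply: (@smooth_near_ext _ _ _ (fun z => row_mx (ploc c Y z)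
  (- (ploc c (Kmap D X0) z *m invmx (Am z))))).
  by apply: filterS nc => z; exact: E1.
have [U [oU Uu] cKE] := smooth_near_family (f := fun i => ploc c (KE i)) sKE.
move: sY sk; rewrite !smooth_pifield_atE -/c => sY sk.
have [U1 [oU1 Uu1] cY] := sY.
have [U2 [oU2 Uu2] ck] := sk.
pose W := U `&` U1 `&` U2 `&` chart_slit c.
have oW : open W.
  by apply: openI; [apply: openI => //; exact: openI|exact: open_chart_slit].
exists W; first by split => //; split => //; exact: (mem_chart_slit HA (dom_base HA u) su).
apply: Cinfty_row_mx => //; first by apply: Cinfty_sub cY => z [[[]]].
apply: CinftyN => //; apply: Cinfty_mulmx => //.
  by apply: Cinfty_sub ck => z [[[]]].
apply: Cinfty_invmx => //; first by move=> z [_ /Au].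
move=> i j; under eq_fun do rewrite mxE.
apply/((Cinfty_rowP _ oW).1); apply: Cinfty_sub (cKE i) => z [[[]]] //.
Qed.

End Connections.

Lemma smooth_near_Cinfty {R : realType} {V W : normedModType R} (U : set V) (f : V -> W) :
  (forall x, U x -> smooth_near f x) -> Cinfty U f.
Proof.
move=> sf k; elim: k f sf => [|k IH] f sf /=.
  move=> x /sf/smooth_near_differentiable; exact: differentiable_continuous.
split => [x /sf|v]; first exact: smooth_near_differentiable.
by apply: IH => x /sf [U' oU' cf]; exists U' => //; exact: Cinfty_derive.
Qed.

Lemma derive_scale_arg {R : realType} {V W : normedModType R} (f : V -> W) (a : R) y v :
  differentiable f (a *: y) ->
  'D_v (fun x => f (a *: x)) y = a *: 'D_v f (a *: y).
Proof.
move=> df; have da : differentiable (fun x : V => a *: x) y by exact: ex_diff.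
have Da : 'D_v (fun x : V => a *: x) y = a *: v.
  by rewrite deriveE // diff_val.
by apply: etrans (derive_comp v da df) _; rewrite Da; exact: derive_dirZ.
Qed.

(** Euler's identity: on the ray through y, f ((1 + t) y) equals f y + t f y as long as 1 + t > 0,
    and both sides are differentiated at t = 0. *)
Lemma derive_homogeneous {R : realType} {V : normedModType R} (f : V -> R) y :
  differentiable f y -> (forall a, 0 < a -> f (a *: y) = a * f y) ->
  'D_y f y = f y.
Proof.
move=> df hf; have d0 : differentiable f (y + (0 : R) *: y) by rewrite scale0r addr0.
have [_] := is_derive_line d0; rewrite scale0r addr0 => <-.
have D1 : is_derive (0 : R) 1 (fun t : R => f y + t *: f y)
    ('D_(f y) id (f y + (0 : R) *: f y)).
  by apply: is_derive_line; exact: ex_diff.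
rewrite derive_id in D1.
have [_ <-] := D1.
apply: near_eq_derive; near=> t.
have t1 : 0 < 1 + t.
  rewrite -ltrBlDl sub0r; near: t; exact: lt_nbhsr.
by rewrite -{1}[y]scale1r -scalerDl hf // mulrDl mul1r.
Unshelve. all: by end_near.
Qed.

(** * Cartan connections *)

Section FinslerMetric.
Context {R : realType} {M : Type} {n : nat} (A : atlas R M n).
Hypothesis HA : smooth_transitions A.
Local Notation TM := (tangent_bundle A).
Local Notation TA := (tatlas A).
Variable L : TM -> R.
Hypothesis HL : finsler_structure L.

Definition energy (x : M) (y : 'rV[R]_n) : R := L (TVec x y) ^+ 2.

Lemma open_neq0 : open [set y : 'rV[R]_n | y != 0].
Proof.
rewrite (_ : [set y | _] = ~` [set 0]).
  by apply: closed_openC; exact/accessible_closed_set1/hausdorff_accessible/norm_hausdorff.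
by apply/seteqP; split => y /eqP.
Qed.

Lemma smooth_energy x : Cinfty [set y | y != 0] (energy x).
Proof.
apply: smooth_near_Cinfty => y y0.
have [U [oU Uu] cL] := finsler_smooth HL (y0 : slit (TVec x y : TM)).
pose c := chart_at A x.
have E y' : L (TVec x y') = (L \o point (a := TA) c) (row_mx (coord c x) y').
  by rewrite -[LHS](congr1 L (point_fibre HA x y')).
pose U' := (fun y => row_mx (coord c x) y) @^-1` U.
have oU' : open U'.
  apply: open_comp => // z _.
  exact/differentiable_continuous/differentiable_row_mxr.
exists U'; first by split => //; have := Uu; rewrite (fibre_coord HA (TVec x y)).
have cL' := Cinfty_fibre (coord c x) oU cL.
apply: (Cinfty_ext oU' _ (CinftyM oU' cL' cL')) => z _.
by rewrite /energy E expr2.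
Qed.

Lemma energy_homogeneous x y a : 0 <= a -> energy x (a *: y) = a ^+ 2 * energy x y.
Proof. by move=> a0; rewrite /energy (finsler_homog HL) // exprMn. Qed.

(** Differentiating the degree 2 homogeneity in y, the chain rule puts one factor a on the left,
    which is cancelled against a^2. *)
Lemma derive_energy_homogeneous x y w a : y != 0 -> 0 < a ->
  'D_w (energy x) (a *: y) = a * 'D_w (energy x) y.
Proof.
move=> y0 a0.
have ay : a *: y != 0 by rewrite scaler_eq0 negb_or gt_eqF.
have d1 := Cinfty_differentiable (smooth_energy x) ay.
have d2 := Cinfty_differentiable (smooth_energy x) y0.
have E1 := derive_scale_arg w d1.
have E2 : 'D_w (fun y' => energy x (a *: y')) y = a ^+ 2 * 'D_w (energy x) y.
  have -> : (fun y' => energy x (a *: y')) = (a ^+ 2) \*: energy x.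
    by apply/funext => y'; exact/energy_homogeneous/ltW.
  by apply: deriveZ; exact: diff_derivable.
apply: (mulfI (lt0r_neq0 a0)); apply: etrans (etrans (esym E1) E2) _.
by rewrite expr2 mulrA.
Qed.

(** The first derivatives of L^2 are homogeneous of degree 1, so Euler's identity removes the
    derivative along [vec u] from the Hessian. *)
Lemma finsler_metric_eta u w : slit u ->
  finsler_metric L u (vec u) w = 2^-1 * 'D_w (energy (base u)) (vec u).
Proof.
move=> su; apply: (congr1 (fun a => 2^-1 * a)).
apply: (derive_homogeneous (f := 'D_w (energy (base u)))) => [|a a0].
  exact: (Cinfty_differentiable (Cinfty_derive w (smooth_energy (base u))) su).
exact: derive_energy_homogeneous.
Qed.

Lemma finsler_metricC u v w : slit u ->
  finsler_metric L u v w = finsler_metric L u w v.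
Proof.
move=> su; apply: (congr1 (fun a => 2^-1 * a)).
exact: (derive_symmetric w v open_neq0 (smooth_energy (base u) 2%N) su).
Qed.

Lemma finsler_metricDl u v v' w : slit u ->
  finsler_metric L u (v + v') w = finsler_metric L u v w + finsler_metric L u v' w.
Proof.
move=> su; apply: etrans _ (mulrDr _ _ _); apply: (congr1 (fun a => 2^-1 * a)).
exact: (derive_dirD v v' (Cinfty_differentiable (Cinfty_derive w (smooth_energy (base u))) su)).
Qed.

Lemma finsler_metricDr u v w w' : slit u ->
  finsler_metric L u v (w + w') = finsler_metric L u v w + finsler_metric L u v w'.
Proof.
move=> su; apply: etrans (finsler_metricC v (w + w') su) _.
apply: etrans (finsler_metricDl w w' v su) _.
exact: (f_equal2 +%R (finsler_metricC w v su) (finsler_metricC w' v su)).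
Qed.

Lemma dir_deriv_vertical (W : normedModType R) (F : TM -> W) u v :
  dir_deriv TA F u (gamma_at u v) = 'D_v (fun y => F (TVec (base u) y)) (vec u).
Proof.
rewrite /dir_deriv gamma_atE // (fibre_coord HA) derive_vertical.
rewrite (_ : (fun y' => _) = fun y => F (TVec (base u) y)) //.
by apply/funext => y; exact: (congr1 F (point_fibre HA (base u) y)).
Qed.

End FinslerMetric.

(** Closes [Kmap_gamma] with a = g(eta, vd T), b = g(V, T) and t = g(T, T), where [vd T] is taken
    along V. *)
Lemma cancel_double (R : realFieldType) (a b t : R) : a + b = b + t + (a + t) -> t = 0.
Proof. by move=> E; lra. Qed.

Section Cartan.
Context {R : realType} {M : Type} {n : nat} (A : atlas R M n).
Hypothesis HA : smooth_transitions A.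
Local Notation TM := (tangent_bundle A).
Local Notation TA := (tatlas A).

(** rho (gamma V) = 0 removes one covariant derivative and reduces the bracket to [vd]: the
    hv-torsion measures how far D along vertical vectors is from the flat derivative. *)
Lemma hv_torsionE (D : connection A) (V Y : pifield A) u :
  linear_connection D -> regular D ->
  smooth_pifield V -> smooth_pifield Y -> slit u ->
  hv_torsion D V Y u = D u (gamma V u) Y - vd Y u (V u).
Proof.
move=> HD HR sV sY su.
have sb : smooth_vfield (beta D Y) by move=> w sw; exact: smooth_beta (sY w sw).
have rb w : slit w -> rho (beta D Y) w = Y w by move=> sw; exact: rho_beta.
have E1 : D u (gamma V u) (rho (beta D Y)) = D u (gamma V u) Y.
  by apply: conn_local => //; apply: smooth_rho => //; exact: sb.
have E2 : D u (beta D Y u) (rho (gamma V)) = 0.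
  rewrite (_ : rho _ = fun=> 0); first exact: conn_sec0.
  by apply/funext => w; exact: rho_gamma.
have E3 : rho (lie_bracket TA (gamma V) (beta D Y)) u = vd Y u (V u).
  rewrite /rho rho_atE // rho_bracket_gamma //; [|exact: sV|exact: sb].
  exact: vd_ext.
by rewrite /hv_torsion /torsion /conn_op /= E1 E2 E3 subr0.
Qed.

Variables (L : TM -> R) (D : connection A).
Hypotheses (HL : finsler_structure L) (HC : cartan_connection L D).
Let HD := cartan_linear HC.
Let HR := cartan_regular HC.

(* With T = T(V, eta), metric compatibility applied to g(eta, T) along gamma V
   and the symmetry of the hv-torsion give 2 g(T, T) = 0. *)
Lemma Kmap_gamma (V : pifield A) u : smooth_pifield V -> slit u ->
  Kmap D (gamma V) u = V u.
Proof.
move=> sV; case: u => x y'; set u : TM := TVec x y' => su.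
have seta : smooth_pifield (@eta R M n A) by move=> w; exact: smooth_eta.
have sG : smooth_vfield (gamma V) by move=> w sw; exact: smooth_gamma (sV w sw).
pose T : pifield A := Kmap D (gamma V) \- V.
have sT : smooth_pifield T.
  move=> w sw; apply: smooth_pifieldB (sV w sw).
  by apply: smooth_Kmap (sG w sw).
have hvT : hv_torsion D V (@eta R M n A) u = T u.
  by rewrite hv_torsionE // vd_eta.
have Keta : conn_op D (gamma V) (@eta R M n A) u = V u + T u.
  by rewrite /T /= addrC subrK.
have KT : conn_op D (gamma V) T u = vd T u (V u) + hv_torsion D V T u.
  by rewrite hv_torsionE // addrC subrK.
have CM := cartan_metric HC sG seta sT su.
have DV := dir_deriv_vertical HA (fun w => finsler_metric L w (@eta R M n A w) (T w)) u (V u).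
set f := energy L (base u).
(* By Euler's identity g(eta, T) is half the derivative of L^2 along T on the fibre. Differentiating
   it along V gives a term with [vd T] and a Hessian term, which is g(T, V). *)
have LHS : 'D_(V u) (fun y => finsler_metric L (TVec (base u) y)
      (@eta R M n A (TVec (base u) y)) (T (TVec (base u) y))) (vec u) =
    finsler_metric L u (vec u) (vd T u (V u)) + finsler_metric L u (T u) (V u).
  have [U [oU Uu] cT] := smooth_fibre HA (sT u su).
  pose O := U `&` [set y : 'rV[R]_n | y != 0].
  have oO : open O by exact: (openI oU (@open_neq0 _ _)).
  have Ou : O (vec u) by exact: (conj Uu su).
  have cf : Cinfty O f by apply: Cinfty_sub (smooth_energy HA HL (base u)) => y [].
  have cTO : Cinfty O (fun y => T (TVec (base u) y)) by apply: Cinfty_sub cT => y [].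
  pose F y := 'D_(T (TVec (base u) y)) f y.
  have cF : Cinfty O F by exact: Cinfty_derive_along_real.
  have dF := Cinfty_differentiable cF Ou.
  have E1 : 'D_(V u) (fun y => finsler_metric L (TVec (base u) y)
      (@eta R M n A (TVec (base u) y)) (T (TVec (base u) y))) (vec u) =
      2^-1 * 'D_(V u) F (vec u).
    pose G (y : 'rV[R]_n) : R := 2^-1 * F y.
    have E2 : 'D_(V u) G (vec u) = 2^-1 * 'D_(V u) F (vec u).
      by apply: deriveZ; exact: diff_derivable.
    have nO : nbhs (vec u) O := open_nbhs_nbhs (conj oO Ou).
    have NE : \forall y \near vec u, finsler_metric L (TVec (base u) y)
        (@eta R M n A (TVec (base u) y)) (T (TVec (base u) y)) = G y.
      apply: filterS nO => y [_ y0].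
      exact: (finsler_metric_eta HA HL (u := TVec (base u) y)).
    exact: etrans (near_eq_derive (V u) NE) E2.
  apply: etrans E1 _.
  apply: etrans (congr1 (fun a => 2^-1 * a) (derive_along_real (V u) oO Ou cf cTO)) _.
  apply: etrans (mulrDr _ _ _) _.
  exact: (f_equal2 +%R (esym (finsler_metric_eta HA HL (vd T u (V u)) su)) erefl).
have {}CM := etrans (esym LHS) (etrans (esym DV) CM).
have HV := cartan_hv HC sV seta sT su.
have G1 := finsler_metricDl HA HL (V u) (T u) (T u) su.
have G2 := finsler_metricDr HA HL (vec u) (vd T u (V u)) (hv_torsion D V T u) su.
have G3 := finsler_metricC HA HL (vec u) (hv_torsion D V T u) su.
have G4 := finsler_metricC HA HL (T u) (V u) su.
rewrite hvT in HV.
have G5 := etrans G2 (congr1 (fun a => _ + a) (etrans G3 (esym HV))).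
rewrite Keta KT in CM.
have {}CM := etrans CM (f_equal2 +%R G1 G5).
rewrite G4 in CM.
have T0 : finsler_metric L u (T u) (T u) = 0.
  exact: cancel_double CM.
have [TV|Tn] := eqVneq (T u) 0; last first.
  by have := finsler_posdef HL su Tn; rewrite T0 ltxx.
by apply/eqP; rewrite -subr_eq0; apply/eqP.
Qed.

End Cartan.

(** * Chern connections *)

Section Chern.
Context {R : realType} {M : Type} {n : nat} (A : atlas R M n).
Hypothesis HA : smooth_transitions A.
Local Notation TM := (tangent_bundle A).
Local Notation TA := (tatlas A).
Implicit Types (u w : TM) (X : vfield A) (V W Y Z : pifield A).

Lemma smooth_pifield_ext Y Y' : (forall w, slit w -> Y w = Y' w) ->
  smooth_pifield Y -> smooth_pifield Y'.
Proof. by move=> E sY w sw; apply: smooth_pifield_at_ext (sY w sw). Qed.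

Lemma smooth_gammaT V : smooth_pifield V -> smooth_vfield (gamma V).
Proof. by move=> sV w sw; apply: smooth_gamma (sV w sw). Qed.

Lemma smooth_rhoT X : smooth_vfield X -> smooth_pifield (rho X).
Proof. by move=> sX w sw; apply: smooth_rho (sX w sw). Qed.

Lemma smooth_bracketT X X' : smooth_vfield X -> smooth_vfield X' ->
  smooth_vfield (lie_bracket TA X X').
Proof.
move=> sX sX' w sw; apply: smooth_lie_bracket; first exact: tatlas_transitions.
  exact: sX.
exact: sX'.
Qed.

Section OneConnection.
Variables (L : TM -> R) (D : connection A).
Hypotheses (HL : finsler_structure L) (HC : cartan_connection L D).
Let HD := cartan_linear HC.
Let HR := cartan_regular HC.

Lemma smooth_betaT V : smooth_pifield V -> smooth_vfield (beta D V).
Proof. by move=> sV w sw; apply: smooth_beta (sV w sw). Qed.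

Lemma smooth_KmapT X : smooth_vfield X -> smooth_pifield (Kmap D X).
Proof. by move=> sX w sw; apply: smooth_Kmap (sX w sw). Qed.

(** A form depending only on the vector xi, whereas [chern] takes a whole field because its torsion
    term does. The part gamma (K xi) of xi is moved from D to the flat derivative. *)
Definition chern_at u xi Y : 'rV[R]_n :=
  D u xi Y - D u (gamma_at u (Kmap_at D u xi)) Y + vd Y u (Kmap_at D u xi).

Lemma chernE X Y u : smooth_vfield X -> smooth_pifield Y -> slit u ->
  chern D X Y u = chern_at u (X u) Y.
Proof.
move=> sX sY su; have sK := smooth_KmapT sX.
by rewrite /chern /= hv_torsionE // opprB addrA addrAC.
Qed.

Lemma gamma_at0 u : gamma_at u 0 = 0 :> 'rV[R]_(n + n).
Proof. by rewrite gamma_atE // row_mx0. Qed.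

Lemma gamma_atB u v v' : gamma_at u (v - v') = gamma_at u v - gamma_at u v'.
Proof. by rewrite !gamma_atE // opp_row_mx add_row_mx subr0. Qed.

Lemma chern_at_dirB_identity (p q r s a b : 'rV[R]_n) :
  (p - q) - (r - s) + (a - b) = (p - r + a) - (q - s + b).
Proof. by apply/rowP => j; rewrite !mxE; ring. Qed.

Lemma chern_at_dirB u xi zeta Y : smooth_pifield Y -> slit u ->
  chern_at u (xi - zeta) Y = chern_at u xi Y - chern_at u zeta Y.
Proof.
move=> sY su; have sYu := sY u su.
rewrite /chern_at Kmap_dirB // gamma_atB !conn_dirB // vd_dirB //.
exact: chern_at_dirB_identity.
Qed.

Lemma chern_at_add u xi Y Y' : smooth_pifield Y -> smooth_pifield Y' -> slit u ->
  chern_at u xi (Y \+ Y') = chern_at u xi Y + chern_at u xi Y'.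
Proof.
move=> sY sY' su; have sYu := sY u su; have sYu' := sY' u su.
rewrite /chern_at !(conn_add HD _ su sYu sYu') vdD //.
move: (D u xi Y) (D u xi Y') (D u (gamma_at _ _) Y) (D u (gamma_at _ _) Y').
move: (vd Y u _) (vd Y' u _) => a b p q r s.
by apply/rowP => j; rewrite !mxE; ring.
Qed.

Lemma chern_at_local u xi Y Y' : slit u -> (forall w, slit w -> Y w = Y' w) ->
  smooth_pifield Y -> chern_at u xi Y = chern_at u xi Y'.
Proof.
move=> su E sY; have sYu := sY u su.
rewrite /chern_at (conn_local HA HD xi su E sYu) (vd_ext _ su E).
by rewrite (conn_local HA HD _ su E sYu).
Qed.

Lemma chern_at_sec0 u xi : slit u -> chern_at u xi (fun=> 0) = 0.
Proof. by move=> su; rewrite /chern_at !conn_sec0 // vd0 subrr addr0. Qed.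

Lemma chern_at_gamma u V Y : smooth_pifield V -> smooth_pifield Y -> slit u ->
  chern_at u (gamma V u) Y = vd Y u (V u).
Proof.
move=> sV sY su; have KV := Kmap_gamma HA HL HC sV su.
rewrite /chern_at (_ : Kmap_at D u (gamma V u) = V u) ?KV //.
by rewrite subrr add0r.
Qed.

Lemma chern_at_beta u V Y : smooth_pifield Y -> slit u ->
  chern_at u (beta D V u) Y = D u (beta D V u) Y.
Proof.
move=> sY su; have K0 := Kmap_beta HA HR V su.
rewrite /chern_at (_ : Kmap_at D u (beta D V u) = 0) ?K0 // gamma_at0.
rewrite conn_dir0 //; last exact: sY.
rewrite subr0 -[RHS]addr0; congr (_ + _).
have := vd_dirB HA 0 0 (sY u su); rewrite !subrr; exact.
Qed.

Lemma smooth_chern X Y : smooth_vfield X -> smooth_pifield Y ->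
  smooth_pifield (chern D X Y).
Proof.
move=> sX sY; have sK := smooth_KmapT sX; have sG := smooth_gammaT sK.
apply: (@smooth_pifield_ext ((conn_op D X Y \- conn_op D (gamma (Kmap D X)) Y)
  \+ (fun w => vd Y w (Kmap D X w)))).
  by move=> w sw; rewrite chernE.
move=> w sw; have sYw := sY w sw.
apply: smooth_pifieldD; last by apply: smooth_vd => //; exact: sK.
apply: smooth_pifieldB.
  exact: (conn_smooth HD sw (sX w sw) sYw).
exact: (conn_smooth HD sw (sG w sw) sYw).
Qed.

(** K (gamma (K X)) = K X by [Kmap_gamma], so the difference is annihilated by K, and subtracting a
    vertical vector leaves rho X unchanged. *)
Lemma split_field X u : smooth_vfield X -> slit u ->
  X u - gamma (Kmap D X) u = beta D (rho X) u.
Proof.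
move=> sX su; have sK := smooth_KmapT sX; apply: (beta_at_unique HA HD HR su).
  rewrite Kmap_dirB //.
  by rewrite -/(Kmap D X u) -/(Kmap D (gamma (Kmap D X)) u) (Kmap_gamma HA HL HC) // subrr.
by rewrite rho_atB // -/(rho (gamma (Kmap D X)) u) rho_gamma // subr0.
Qed.

Definition chern_torsion X X' u :=
  chern_at u (X u) (rho X') - chern_at u (X' u) (rho X) - lsubmx (lie_bracket TA X X' u).

Lemma chern_torsionC X X' u : chern_torsion X X' u = - chern_torsion X' X u.
Proof.
rewrite /chern_torsion lie_bracketC linearN /=.
move: (chern_at _ _ _) (chern_at _ _ _) (lsubmx _) => a b c.
by apply/rowP => j; rewrite !mxE; ring.
Qed.

(** Along gamma V the connection is [vd], and the bracket contributes exactly the same [vd]. *)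
Lemma chern_torsion_gamma V X u : smooth_pifield V -> smooth_vfield X -> slit u ->
  chern_torsion (gamma V) X u = 0.
Proof.
move=> sV sX su; have sr := smooth_rhoT sX.
rewrite /chern_torsion chern_at_gamma // rho_bracket_gamma //; [|exact: sV|exact: sX].
rewrite (_ : rho (gamma V) = fun=> 0) ?chern_at_sec0 // ?subr0 ?subrr //.
by apply/funext => w; exact: rho_gamma.
Qed.

(** Along horizontal fields the Chern and Cartan connections coincide, so this is the vanishing of
    Q. *)
Lemma chern_torsion_beta V W u : smooth_pifield V -> smooth_pifield W -> slit u ->
  chern_torsion (beta D V) (beta D W) u = 0.
Proof.
move=> sV sW su; have := cartan_hh HC sV sW su.
have sbV := smooth_betaT sV; have sbW := smooth_betaT sW.
rewrite /hh_torsion /torsion /conn_op /= => H; rewrite /chern_torsion.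
rewrite !chern_at_beta //; [|exact: smooth_rhoT|exact: smooth_rhoT].
by move: H; rewrite /rho (rho_atE HA u (lie_bracket _ _ _ _)).
Qed.

Lemma torsion_split_identity (a b c g d e : 'rV[R]_n) : e = 0 -> g - e - d = 0 ->
  a - b - c = (a - g) - b - (c - d).
Proof.
move=> -> /eqP; rewrite subr0 subr_eq0 => /eqP ->.
by apply/rowP => j; rewrite !mxE; ring.
Qed.

(** The torsion is additive in its first field, and the vertical part gamma (K X) contributes
    nothing. *)
Lemma chern_torsion_split X X' u : smooth_vfield X -> smooth_vfield X' -> slit u ->
  chern_torsion X X' u = chern_torsion (beta D (rho X)) X' u.
Proof.
move=> sX sX' su; have sK := smooth_KmapT sX; have sG := smooth_gammaT sK.
have sr := smooth_rhoT sX; have sr' := smooth_rhoT sX'; have sb := smooth_betaT sr.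
have E w : slit w -> (X \- gamma (Kmap D X)) w = beta D (rho X) w.
  exact: split_field.
have E1 : chern_at u (beta D (rho X) u) (rho X') =
    chern_at u (X u) (rho X') - chern_at u (gamma (Kmap D X) u) (rho X').
  by rewrite -(E u su); exact: chern_at_dirB.
have E2 : chern_at u (X' u) (rho (beta D (rho X))) = chern_at u (X' u) (rho X).
  exact: (chern_at_local (X' u) su (fun w sw => rho_beta HA HR (rho X) sw) (smooth_rhoT sb)).
have E3 : chern_at u (X' u) (rho (gamma (Kmap D X))) = 0.
  rewrite (_ : rho _ = fun=> 0); first exact: chern_at_sec0.
  by apply/funext => w; exact: rho_gamma.
have E4 : lsubmx (lie_bracket TA (beta D (rho X)) X' u) =
    lsubmx (lie_bracket TA X X' u) - lsubmx (lie_bracket TA (gamma (Kmap D X)) X' u).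
  have F1 := lie_bracketBl (sX u su) (sG u su) (sX' u su).
  have F2 := lie_bracket_ext HA su E (fun w _ => erefl (X' w)).
  exact: etrans (congr1 lsubmx (etrans (esym F2) F1)) (linearB _ _ _).
have G0 := chern_torsion_gamma sK sX' su.
exact: etrans (torsion_split_identity _ _ _ E3 G0)
  (esym (f_equal3 (fun x y z => x - y - z) E1 E2 E4)).
Qed.

Lemma chern_torsion_free X X' u : smooth_vfield X -> smooth_vfield X' -> slit u ->
  rho (lie_bracket TA X X') u = chern D X (rho X') u - chern D X' (rho X) u.
Proof.
move=> sX sX' su.
have sr := smooth_rhoT sX; have sr' := smooth_rhoT sX'.
have sb := smooth_betaT sr; have sb' := smooth_betaT sr'.
have : chern_torsion X X' u = 0.
  (* Antisymmetry brings the second slot to the front for the same splitting, which leaves two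
     horizontal fields. *)
  rewrite chern_torsion_split // chern_torsionC chern_torsion_split //.
  by rewrite chern_torsion_beta ?oppr0.
rewrite /chern_torsion -!chernE // => /eqP; rewrite subr_eq0 => /eqP ->.
by rewrite /rho rho_atE.
Qed.

Local Notation C := (chern D).

Lemma chern_fieldB X X1 X2 Z u : smooth_vfield X -> smooth_vfield X1 ->
  smooth_vfield X2 -> smooth_pifield Z -> slit u -> X u = X1 u - X2 u ->
  C X Z u = C X1 Z u - C X2 Z u.
Proof.
move=> sX sX1 sX2 sZ su E; apply: etrans (chernE sX sZ su) _; rewrite E.
apply: etrans (chern_at_dirB _ _ sZ su) _.
exact: esym (f_equal2 (fun x y => x - y) (chernE sX1 sZ su) (chernE sX2 sZ su)).
Qed.

Lemma chern_secD X Z Z' Z'' u : smooth_vfield X -> smooth_pifield Z ->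
  smooth_pifield Z' -> smooth_pifield Z'' -> slit u ->
  (forall w, slit w -> Z w = Z' w + Z'' w) -> C X Z u = C X Z' u + C X Z'' u.
Proof.
move=> sX sZ sZ' sZ'' su E; apply: etrans (chernE sX sZ su) _.
apply: etrans (chern_at_local (Y' := Z' \+ Z'') (X u) su E sZ) _.
apply: etrans (chern_at_add (X u) sZ' sZ'' su) _.
exact: esym (f_equal2 +%R (chernE sX sZ' su) (chernE sX sZ'' su)).
Qed.

Lemma chern_local X Z Z' u : smooth_vfield X -> smooth_pifield Z -> slit u ->
  (forall w, slit w -> Z w = Z' w) -> C X Z u = C X Z' u.
Proof.
move=> sX sZ su E; have sZ' := smooth_pifield_ext E sZ.
apply: etrans (chernE sX sZ su) _; apply: etrans (chern_at_local (X u) su E sZ) _.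
exact: esym (chernE sX sZ' su).
Qed.

Lemma chern_secB X Z Z' Z'' u : smooth_vfield X -> smooth_pifield Z ->
  smooth_pifield Z' -> smooth_pifield Z'' -> slit u ->
  (forall w, slit w -> Z w = Z' w - Z'' w) -> C X Z u = C X Z' u - C X Z'' u.
Proof.
move=> sX sZ sZ' sZ'' su E; apply/eqP; rewrite eq_sym subr_eq; apply/eqP.
by apply: chern_secD => // w sw; rewrite E // subrK.
Qed.

Lemma curvatureC_identity (a b c d : 'rV[R]_n) : c = - d -> a - b + c = - (b - a + d).
Proof. by move=> ->; apply/rowP => j; rewrite !mxE; ring. Qed.

Lemma curvatureB_identity (a a1 a2 b b1 b2 c c1 c2 : 'rV[R]_n) :
  a = a1 - a2 -> b = b1 - b2 -> c = c1 - c2 ->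
  a - b + c = (a1 - b1 + c1) - (a2 - b2 + c2).
Proof. by move=> -> -> ->; apply/rowP => j; rewrite !mxE; ring. Qed.

Lemma chern_curvatureC X X' Z u : smooth_vfield X -> smooth_vfield X' ->
  smooth_pifield Z -> slit u -> curvature C X X' Z u = - curvature C X' X Z u.
Proof.
move=> sX sX' sZ su.
have s1 := smooth_bracketT sX sX'; have s2 := smooth_bracketT sX' sX.
have Z0 : chern_at u 0 Z = 0 by rewrite -(subrr 0) chern_at_dirB // subrr.
have := chern_at_dirB 0 (lie_bracket TA X' X u) sZ su.
rewrite Z0 !sub0r -lie_bracketC => E.
have {}E := etrans (chernE s1 sZ su) (etrans E (esym (congr1 -%R (chernE s2 sZ su)))).
exact: curvatureC_identity E.
Qed.

(** The decomposition of X is assumed on all of [slit], not only at u, because the iterated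
    derivative and the bracket differentiate it. *)
Lemma chern_curvatureBl X X1 X2 X' Z u : smooth_vfield X -> smooth_vfield X1 ->
  smooth_vfield X2 -> smooth_vfield X' -> smooth_pifield Z -> slit u ->
  (forall w, slit w -> X w = X1 w - X2 w) ->
  curvature C X X' Z u = curvature C X1 X' Z u - curvature C X2 X' Z u.
Proof.
move=> sX sX1 sX2 sX' sZ su E.
have sC1 := smooth_chern sX1 sZ; have sC2 := smooth_chern sX2 sZ.
have sC := smooth_chern sX sZ; have sC' := smooth_chern sX' sZ.
have s0 := smooth_bracketT sX sX'.
have s1 := smooth_bracketT sX1 sX'; have s2 := smooth_bracketT sX2 sX'.
have F1 := chern_secB sX' sC sC1 sC2 su
  (fun w sw => chern_fieldB sX sX1 sX2 sZ sw (E w sw)).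
have F2 := chern_fieldB sX sX1 sX2 sC' su (E u su).
have B : lie_bracket TA X X' u = lie_bracket TA X1 X' u - lie_bracket TA X2 X' u.
  apply: etrans _ (lie_bracketBl (sX1 u su) (sX2 u su) (sX' u su)).
  exact: (lie_bracket_ext HA (X' := X1 \- X2) su E (fun w _ => erefl (X' w))).
exact: curvatureB_identity F1 F2 (chern_fieldB s0 s1 s2 sZ su B).
Qed.

Lemma chern_curvatureBr X X' X1 X2 Z u : smooth_vfield X -> smooth_vfield X' ->
  smooth_vfield X1 -> smooth_vfield X2 -> smooth_pifield Z -> slit u ->
  (forall w, slit w -> X' w = X1 w - X2 w) ->
  curvature C X X' Z u = curvature C X X1 Z u - curvature C X X2 Z u.
Proof.
move=> sX sX' sX1 sX2 sZ su E.
apply: etrans (chern_curvatureC sX sX' sZ su) _.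
apply: etrans (congr1 -%R (chern_curvatureBl sX' sX1 sX2 sX sZ su E)) _.
apply: etrans (opprD _ _) _.
exact: (f_equal2 (fun x y => x - y) (esym (chern_curvatureC sX sX1 sZ su))
  (esym (chern_curvatureC sX sX2 sZ su))).
Qed.

Lemma chern_v_curvature V W Z u : smooth_pifield V -> smooth_pifield W ->
  smooth_pifield Z -> slit u -> v_curvature C V W Z u = 0.
Proof.
move=> sV sW sZ su.
have sGV := smooth_gammaT sV; have sGW := smooth_gammaT sW.
have CE U Y w : smooth_pifield U -> smooth_pifield Y -> slit w ->
    C (gamma U) Y w = vd Y w (U w).
  move=> sU sY sw.
  exact: etrans (chernE (smooth_gammaT sU) sY sw) (chern_at_gamma sU sY sw).
have E1 := etrans (CE W _ u sW (smooth_chern sGV sZ) su)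
  (vd_ext (W u) su (fun w sw => CE V Z w sV sZ sw)).
have E2 := etrans (CE V _ u sV (smooth_chern sGW sZ) su)
  (vd_ext (V u) su (fun w sw => CE W Z w sW sZ sw)).
pose U1 : pifield A := fun w => vd V w (W w).
pose U2 : pifield A := fun w => vd W w (V w).
have sU : smooth_pifield (U2 \- U1).
  move=> w sw; apply: smooth_pifieldB.
    exact: smooth_vd (sW w sw) (sV w sw).
  exact: smooth_vd (sV w sw) (sW w sw).
have sB := smooth_bracketT sGV sGW.
have E3 : C (lie_bracket TA (gamma V) (gamma W)) Z u = vd Z u (U2 u - U1 u).
  apply: etrans (chernE sB sZ su) _.
  rewrite bracket_gamma_gamma //; [|exact: sV|exact: sW].
  exact: (chern_at_gamma sU sZ su).
(* The iterated derivatives yield [vd Z] along U1 - U2, the bracket term yields it along U2 - U1;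
   linearity in the direction makes them cancel. *)
have E4 := vd_commutator HA (sZ u su) (sV u su) (sW u su).
have E5 := vd_dirD HA (U1 u - U2 u) (U2 u - U1 u) (sZ u su).
have E6 : vd Z u 0 = 0 by have := vd_dirB HA 0 0 (sZ u su); rewrite !subrr.
have E7 : U1 u - U2 u + (U2 u - U1 u) = 0 by rewrite addrA subrK subrr.
rewrite E7 E6 in E5.
exact: etrans (f_equal2 +%R (etrans (f_equal2 (fun x y => x - y) E1 E2) E4) E3) (esym E5).
Qed.

End OneConnection.
End Chern.

(** * Comparison of the two Chern connections *)

Section TwoConnections.
Context {R : realType} {M : Type} {n : nat} (A : atlas R M n).
Hypothesis HA : smooth_transitions A.
Local Notation TM := (tangent_bundle A).
Local Notation TA := (tatlas A).
Implicit Types (u w : TM) (X : vfield A) (V W Y Z P : pifield A).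
Variables (L Lt : TM -> R) (D Dt : connection A).
Hypotheses (HL : finsler_structure L) (HC : cartan_connection L D).
Hypotheses (HLt : finsler_structure Lt) (HCt : cartan_connection Lt Dt).
Local Notation C := (chern D).
Local Notation Ct := (chern Dt).
Local Notation B := (Bc D Dt).

Lemma smooth_Bc V Y : smooth_pifield V -> smooth_pifield Y -> smooth_pifield (B V Y).
Proof.
move=> sV sY; have sb := smooth_betaT HA HC sV.
have s1 := smooth_chern HA HC sb sY; have s2 := smooth_chern HA HCt sb sY.
by move=> w sw; apply: smooth_pifieldB; [exact: s2|exact: s1].
Qed.

Lemma chern_change_identity (a b v : 'rV[R]_n) : a = b + ((a - v) - (b - v)).
Proof. by rewrite addrKB addrC subrK. Qed.

(** Both Chern connections are [vd] along gamma (K X), so their difference along X is their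
    difference along X - gamma (K X), which at u is beta P. *)
Lemma chern_change X P Y u : smooth_vfield X -> smooth_pifield P -> smooth_pifield Y ->
  slit u -> rho X u = P u -> Ct X Y u = C X Y u + B P Y u.
Proof.
move=> sX sP sY su rP; have sb := smooth_betaT HA HC sP.
have sK := smooth_KmapT HA HC sX.
have E : beta D P u = X u - gamma (Kmap D X) u.
  by apply: etrans (esym (split_field HA HL HC sX su)); rewrite /beta rP.
have sG := smooth_gammaT HA sK.
have F := chern_fieldB HA HC sb sX sG sY su E.
have Ft := chern_fieldB HA HCt sb sX sG sY su E.
have G := etrans (chernE HA HC sG sY su) (chern_at_gamma HA HL HC sK sY su).
have Gt := etrans (chernE HA HCt sG sY su) (chern_at_gamma HA HLt HCt sK sY su).
have {}F := etrans F (congr1 (fun x => _ - x) G).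
have {}Ft := etrans Ft (congr1 (fun x => _ - x) Gt).
apply: etrans _ (congr1 (fun x => C X Y u + x) (esym (f_equal2 (fun x y => x - y) Ft F))).
exact: chern_change_identity.
Qed.

Lemma Bc_secD V Y Y' Y'' u : smooth_pifield V -> smooth_pifield Y ->
  smooth_pifield Y' -> smooth_pifield Y'' -> slit u ->
  (forall w, slit w -> Y w = Y' w + Y'' w) -> B V Y u = B V Y' u + B V Y'' u.
Proof.
move=> sV sY sY' sY'' su E; have sb := smooth_betaT HA HC sV.
apply: etrans (f_equal2 (fun x y => x - y)
  (chern_secD HA HCt sb sY sY' sY'' su E) (chern_secD HA HC sb sY sY' sY'' su E)) _.
exact: subrDACA.
Qed.

Lemma Bc_secB V Y Y' Y'' u : smooth_pifield V -> smooth_pifield Y ->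
  smooth_pifield Y' -> smooth_pifield Y'' -> slit u ->
  (forall w, slit w -> Y w = Y' w - Y'' w) -> B V Y u = B V Y' u - B V Y'' u.
Proof.
move=> sV sY sY' sY'' su E; apply/eqP; rewrite eq_sym subr_eq; apply/eqP.
by apply: Bc_secD => // w sw; rewrite E // subrK.
Qed.

Lemma beta_atB u v v' : slit u -> beta_at D u (v - v') = beta_at D u v - beta_at D u v'.
Proof.
move=> su; have [K1 r1] := beta_atP HA (cartan_regular HC) v su.
have [K2 r2] := beta_atP HA (cartan_regular HC) v' su.
apply/esym/(beta_at_unique HA (cartan_linear HC) (cartan_regular HC)) => //.
  by rewrite (Kmap_dirB HA (cartan_linear HC)) // K1 K2 subrr.
by rewrite rho_atB // r1 r2.
Qed.

(** The hypothesis at u alone suffices since the first argument enters only through [beta_at]; the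
    second one is differentiated and is therefore controlled on all of [slit] in [Bc_secB]. *)
Lemma Bc_argB V V1 V2 Y u : smooth_pifield V -> smooth_pifield V1 ->
  smooth_pifield V2 -> smooth_pifield Y -> slit u -> V u = V1 u - V2 u ->
  B V Y u = B V1 Y u - B V2 Y u.
Proof.
move=> sV sV1 sV2 sY su E.
have sb := smooth_betaT HA HC sV.
have sb1 := smooth_betaT HA HC sV1; have sb2 := smooth_betaT HA HC sV2.
have bE : beta D V u = beta D V1 u - beta D V2 u by rewrite /beta E beta_atB.
apply: etrans (f_equal2 (fun x y => x - y)
  (chern_fieldB HA HCt sb sb1 sb2 sY su bE) (chern_fieldB HA HC sb sb1 sb2 sY su bE)) _.
exact: subrBACA.
Qed.

Lemma Bc_arg0 V Y u : smooth_pifield V -> smooth_pifield Y -> slit u ->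
  V u = 0 -> B V Y u = 0.
Proof.
move=> sV sY su V0; have E : V u = V u - V u by rewrite V0 subrr.
by rewrite (Bc_argB sV sV sV sY su E) subrr.
Qed.

Lemma Bc_sec0 V Y u : smooth_pifield V -> smooth_pifield Y -> slit u ->
  (forall w, slit w -> Y w = 0) -> B V Y u = 0.
Proof.
move=> sV sY su Y0.
have E w : slit w -> Y w = Y w - Y w by move=> /Y0 ->; rewrite subrr.
by rewrite (Bc_secB sV sY sY sY su E) subrr.
Qed.

Lemma chern_sec0 X Y u : smooth_vfield X -> smooth_pifield Y -> slit u ->
  (forall w, slit w -> Y w = 0) -> C X Y u = 0.
Proof.
move=> sX sY su Y0.
have E w : slit w -> Y w = Y w - Y w by move=> /Y0 ->; rewrite subrr.
by rewrite (chern_secB HA HC sX sY sY sY su E) subrr.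
Qed.

(** Here a, b, c, d are the four terms of Ct_X' (Ct_X Z), the primed ones those with X and X'
    exchanged, and e, f, f' come from the bracket term. *)
Lemma curvature_change_identity (a b c d a' b' c' d' e f f' : 'rV[R]_n) :
  ((a + b) + (c + d)) - ((a' + b') + (c' + d')) + (e + (f - f')) =
  (a - a' + e) - (b' - f - c) + (b - f' - c') - d' + d.
Proof. by apply/rowP => j; rewrite !mxE; ring. Qed.

(** Each Ct is expanded by [chern_change]. Torsion-freeness rewrites B(rho [X, X'], Z) as B(C_X P',
    Z) - B(C_X' P, Z), exactly the terms that complete the two covariant derivatives of B. P and P'
    are kept apart from rho X and rho X' because for a lift of a given section the projection
    returns that section only on [slit]. *)
Lemma curvature_change X X' P P' Z u : smooth_vfield X -> smooth_vfield X' ->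
  smooth_pifield P -> smooth_pifield P' -> smooth_pifield Z -> slit u ->
  (forall w, slit w -> rho X w = P w) -> (forall w, slit w -> rho X' w = P' w) ->
  curvature Ct X X' Z u = curvature C X X' Z u
    - cov_deriv2 C X B P' Z u + cov_deriv2 C X' B P Z u
    - B P (B P' Z) u + B P' (B P Z) u.
Proof.
move=> sX sX' sP sP' sZ su rP rP'.
have sC := smooth_chern HA HC sX sZ; have sC' := smooth_chern HA HC sX' sZ.
have sCt := smooth_chern HA HCt sX sZ; have sCt' := smooth_chern HA HCt sX' sZ.
have sB := smooth_Bc sP sZ; have sB' := smooth_Bc sP' sZ.
have sCP' := smooth_chern HA HC sX sP'; have sCP := smooth_chern HA HC sX' sP.
have CB w (sw : slit w) := chern_change sX sP sZ sw (rP w sw).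
have CB' w (sw : slit w) := chern_change sX' sP' sZ sw (rP' w sw).
have E1 := etrans (chern_change sX' sP' sCt su (rP' u su))
  (f_equal2 +%R (chern_secD HA HC sX' sCt sC sB su CB) (Bc_secD sP' sCt sC sB su CB)).
have E2 := etrans (chern_change sX sP sCt' su (rP u su))
  (f_equal2 +%R (chern_secD HA HC sX sCt' sC' sB' su CB') (Bc_secD sP sCt' sC' sB' su CB')).
have sb := smooth_bracketT HA sX sX'; have sr := smooth_rhoT HA sb.
have F : rho (lie_bracket TA X X') u = C X P' u - C X' P u.
  apply: etrans (chern_torsion_free HA HL HC sX sX' su) _.
  exact: (f_equal2 (fun x y => x - y)
    (chern_local HA HC sX (smooth_rhoT HA sX') su rP')
    (chern_local HA HC sX' (smooth_rhoT HA sX) su rP)).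
have E3 := etrans (chern_change sb sr sZ su erefl)
  (congr1 (fun x => _ + x) (Bc_argB sr sCP' sCP sZ su F)).
apply: etrans (f_equal2 +%R (f_equal2 (fun x y => x - y) E1 E2) E3) _.
exact: curvature_change_identity.
Qed.

Lemma cov_derivB_identity (a a1 a2 b b1 b2 c c1 c2 : 'rV[R]_n) :
  a = a1 - a2 -> b = b1 - b2 -> c = c1 - c2 ->
  a - b - c = (a1 - b1 - c1) - (a2 - b2 - c2).
Proof. by move=> -> -> ->; apply/rowP => j; rewrite !mxE; ring. Qed.

Lemma cov_deriv2_fieldB X X1 X2 Y Z u : smooth_vfield X -> smooth_vfield X1 ->
  smooth_vfield X2 -> smooth_pifield Y -> smooth_pifield Z -> slit u ->
  (forall w, slit w -> X w = X1 w - X2 w) ->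
  cov_deriv2 C X B Y Z u = cov_deriv2 C X1 B Y Z u - cov_deriv2 C X2 B Y Z u.
Proof.
move=> sX sX1 sX2 sY sZ su E; have sB := smooth_Bc sY sZ.
have CE V (sV : smooth_pifield V) w (sw : slit w) :=
  chern_fieldB HA HC sX sX1 sX2 sV sw (E w sw).
have s V (sV : smooth_pifield V) := smooth_chern HA HC sX sV.
have s1 V (sV : smooth_pifield V) := smooth_chern HA HC sX1 sV.
have s2 V (sV : smooth_pifield V) := smooth_chern HA HC sX2 sV.
exact: cov_derivB_identity (CE _ sB u su)
  (Bc_argB (s _ sY) (s1 _ sY) (s2 _ sY) sZ su (CE _ sY u su))
  (Bc_secB sY (s _ sZ) (s1 _ sZ) (s2 _ sZ) su (CE _ sZ)).
Qed.

Lemma cov_deriv2_arg0 X Y Z u : smooth_vfield X -> smooth_pifield Y ->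
  smooth_pifield Z -> slit u -> (forall w, slit w -> Y w = 0) ->
  cov_deriv2 C X B Y Z u = 0.
Proof.
move=> sX sY sZ su Y0; have sB := smooth_Bc sY sZ.
have E1 := chern_sec0 sX sB su (fun w sw => Bc_arg0 sY sZ sw (Y0 w sw)).
have E2 := Bc_arg0 (smooth_chern HA HC sX sY) sZ su (chern_sec0 sX sY su Y0).
have E3 := Bc_arg0 sY (smooth_chern HA HC sX sZ) su (Y0 u su).
apply: etrans (f_equal2 (fun x y => x - y) (f_equal2 (fun x y => x - y) E1 E2) E3) _.
by rewrite !subr0.
Qed.

Local Notation N := (Nmap D Dt).

(** The term subtracted in [Nmap] is K (beta V) = 0. *)
Lemma NmapE V w : slit w -> N V w = Kmap Dt (beta D V) w.
Proof.
move=> sw; rewrite -[RHS]subr0.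
by rewrite -(Kmap_beta HA (cartan_regular HC) V sw).
Qed.

Lemma smooth_Nmap V : smooth_pifield V -> smooth_pifield (N V).
Proof.
move=> sV; have sK := smooth_KmapT HA HCt (smooth_betaT HA HC sV).
by apply: (smooth_pifield_ext HA _ sK) => w sw; rewrite NmapE.
Qed.

(** This is [split_field] of the second connection applied to beta V, whose vertical part relative
    to Dt is gamma (N V). *)
Lemma beta_change V w : smooth_pifield V -> slit w ->
  beta Dt V w = beta D V w - gamma (N V) w.
Proof.
move=> sV sw; have sb := smooth_betaT HA HC sV.
have := split_field HA HLt HCt sb sw.
rewrite {1}/gamma -NmapE // -/(gamma (N V) w) => ->.
by rewrite /beta (rho_beta HA (cartan_regular HC) V sw).
Qed.

(** Since rho (gamma Y) = 0, only one of the four correction terms of [curvature_change] remains.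
    Replacing betat X by beta X costs the curvature on (gamma (N X), gamma Y), a v-curvature, which
    vanishes. *)
Lemma chern_hv_curvature_change (X Y Z : pifield A) u :
  smooth_pifield X -> smooth_pifield Y -> smooth_pifield Z -> slit u ->
  hv_curvature (beta Dt) Ct X Y Z u =
  hv_curvature (beta D) C X Y Z u + cov_deriv2 C (gamma Y) B X Z u.
Proof.
move=> sX sY sZ su.
have sb := smooth_betaT HA HC sX; have sbt := smooth_betaT HA HCt sX.
have sN := smooth_Nmap sX; have sGN := smooth_gammaT HA sN.
have sG := smooth_gammaT HA sY.
(* Stands for rho (gamma Y) as the section P' of [curvature_change]. *)
pose O : pifield A := fun=> 0.
have sO : smooth_pifield O by move=> w _; exact: smooth_pifield0.
have O0 w : slit w -> O w = 0 by [].
have rG w : slit w -> rho (gamma Y) w = O w by move=> _; exact: rho_gamma.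
have rb w : slit w -> rho (beta Dt X) w = X w.
  exact: (rho_beta HA (cartan_regular HCt) X).
apply: etrans (curvature_change sbt sG sX sO sZ su rb rG) _.
have E1 := chern_curvatureBl HA HC sbt sb sGN sG sZ su (fun w => beta_change sX).
have E2 := chern_v_curvature HA HL HC sN sY sZ su.
have E3 := cov_deriv2_arg0 sbt sO sZ su O0.
have E4 := Bc_sec0 sX (smooth_Bc sO sZ) su (fun w sw => Bc_arg0 sO sZ sw (O0 w sw)).
have E5 := Bc_arg0 sO (smooth_Bc sX sZ) su (O0 u su).
have {}E1 := etrans E1 (congr1 (fun x => _ - x) E2).
apply: etrans (f_equal2 +%R (f_equal2 (fun x y => x - y) (f_equal2 +%R
  (f_equal2 (fun x y => x - y) E1 E3) erefl) E4) E5) _.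
by rewrite !subr0 addr0.
Qed.

(** Here r is the curvature on (beta X, beta Y), p = P(X, N Y), q = P(Y, N X), and 0 is the
    v-curvature. The covariant derivatives of B at (Y, Z) along beta X and gamma (N X) are c1 and
    c2, those with X and Y exchanged are primed; d' = B(X, B(Y, Z)) and d = B(Y, B(X, Z)). *)
Lemma h_curvature_identity (r p q c1 c2 c1' c2' d d' : 'rV[R]_n) :
  ((r - p) - (- q - 0)) - (c1 - c2) + (c1' - c2') - d' + d =
  r + ((c2 - c1 + q - d') - (c2' - c1' + p - d)).
Proof. by apply/rowP => j; rewrite !mxE; ring. Qed.

Lemma chern_h_curvature_change (X Y Z : pifield A) u :
  smooth_pifield X -> smooth_pifield Y -> smooth_pifield Z -> slit u ->
  h_curvature (beta Dt) Ct X Y Z u =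
  h_curvature (beta D) C X Y Z u
  + antisym (fun V W =>
      cov_deriv2 C (gamma (N V)) B W Z
      \- cov_deriv2 C (beta D V) B W Z
      \+ hv_curvature (beta D) C W (N V) Z
      \- B V (B W Z)) X Y u.
Proof.
move=> sX sY sZ su.
have sbX := smooth_betaT HA HC sX; have sbtX := smooth_betaT HA HCt sX.
have sbY := smooth_betaT HA HC sY; have sbtY := smooth_betaT HA HCt sY.
have sNX := smooth_Nmap sX; have sGX := smooth_gammaT HA sNX.
have sNY := smooth_Nmap sY; have sGY := smooth_gammaT HA sNY.
have rb V w : slit w -> rho (beta Dt V) w = V w.
  exact: (rho_beta HA (cartan_regular HCt) V).
have bX w : slit w -> beta Dt X w = beta D X w - gamma (N X) w := beta_change sX.
have bY w : slit w -> beta Dt Y w = beta D Y w - gamma (N Y) w := beta_change sY.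
apply: etrans (curvature_change sbtX sbtY sX sY sZ su (rb X) (rb Y)) _.
have E1 := chern_curvatureBl HA HC sbtX sbX sGX sbtY sZ su bX.
have E2 := chern_curvatureBr HA HC sbX sbtY sbY sGY sZ su bY.
have E3 := chern_curvatureBr HA HC sGX sbtY sbY sGY sZ su bY.
have E4 := chern_v_curvature HA HL HC sNX sNY sZ su.
(* The hv-curvature takes the horizontal lift first, so the curvature on (gamma (N X), beta Y) is
   -P(Y, N X). With the minus sign of betat it enters positively, which explains the order of
   arguments in that term of the result. *)
have E5 := chern_curvatureC HA HC sGX sbY sZ su.
have {}E3 := etrans E3 (f_equal2 (fun x y => x - y) E5 E4).
have {}E1 := etrans E1 (f_equal2 (fun x y => x - y) E2 E3).
have E6 := cov_deriv2_fieldB sbtX sbX sGX sY sZ su bX.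
have E7 := cov_deriv2_fieldB sbtY sbY sGY sX sZ su bY.
apply: etrans (f_equal2 +%R (f_equal2 (fun x y => x - y) (f_equal2 +%R
  (f_equal2 (fun x y => x - y) E1 E6) E7) erefl) erefl) _.
exact: h_curvature_identity.
Qed.

End TwoConnections.

Theorem theorem2p8 (R : realType) (n : nat) (M : topologicalType)
    (A : atlas R M n) (hA : is_manifold A)
    (L Lt : tangent_bundle A -> R)
    (hL : finsler_structure L) (hLt : finsler_structure Lt)
    (sigma : M -> R) (sigma_pos : forall x, 0 < sigma x)
    (sigma_smooth : forall x, smooth_at A sigma x)
    (hconf : conformally_related sigma L Lt)
    (nabla nablat : connection A)
    (hnabla : cartan_connection L nabla)
    (hnablat : cartan_connection Lt nablat)
    (X Y Z : pifield A)
    (hX : smooth_pifield X) (hY : smooth_pifield Y) (hZ : smooth_pifield Z) :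
  let Dc := chern nabla in
  let Dct := chern nablat in
  let b := beta nabla in
  let bt := beta nablat in
  let N := Nmap nabla nablat in
  let B := Bc nabla nablat in
  forall u : tangent_bundle A, slit u ->
  [/\ v_curvature Dct X Y Z u = 0 /\ v_curvature Dc X Y Z u = 0,
      hv_curvature bt Dct X Y Z u =
        hv_curvature b Dc X Y Z u + cov_deriv2 Dc (gamma Y) B X Z u
    & h_curvature bt Dct X Y Z u =
        h_curvature b Dc X Y Z u
        + antisym (fun V W =>
            cov_deriv2 Dc (gamma (N V)) B W Z
            \- cov_deriv2 Dc (b V) B W Z
            \+ hv_curvature b Dc W (N V) Z
            \- B V (B W Z)) X Y u].
Proof.
move=> Dc Dct b bt N B u su; have [_ _ /smooth_atlas_transitions HA] := hA.
split; first split.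
- exact: (chern_v_curvature HA hLt hnablat hX hY hZ su).
- exact: (chern_v_curvature HA hL hnabla hX hY hZ su).
- exact: (chern_hv_curvature_change HA hL hnabla hLt hnablat hX hY hZ su).
- exact: (chern_h_curvature_change HA hL hnabla hLt hnablat hX hY hZ su).
Qed.
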